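(* Let $T$ be an $\omega$-stable complete first-order theory in a countable language, let $\kappa$ be a singular cardinal of cofinality $\lambda > \aleph_0$, and let $d < \omega$. Then whenever $M \models T$, $A \subseteq M$ has size less than $\mathrm{cof}(\kappa)$, and $X \subseteq M^d$ has size $\geq \kappa$, there is some $Y \subseteq X$ of size $\kappa$ and some equivalence relation $E$ on $Y$, such that $E$ has at most $\lambda$-many equivalence classes, each equivalence class is infinite, and $Y$ is $E$-indiscernible over $A$.
   Context: Let $T$ be a complete first-order theory, $M \models T$, $A \subseteq M$, $Y \subseteq M^d$, and let $E$ be an equivalence relation on $Y$. $Y$ is $E$-indiscernible over $A$ if for every $n<\omega$ and all sequences $\overline{a}_0, \ldots, \overline{a}_{n-1}$ and $\overline{b}_0, \ldots, \overline{b}_{n-1}$ of elements of $Y$, with the $\overline{a}_i$ pairwise distinct and the $\overline{b}_i$ pairwise distinct: if for every $i < j < n$ we have $\overline{a}_i \, E\, \overline{a}_j$ if and only if $\overline{b}_i\, E\, \overline{b}_j$, then $(\overline{a}_0,\ldots,\overline{a}_{n-1})$ and $(\overline{b}_0,\ldots,\overline{b}_{n-1})$ have the same complete type over $A$ in $M$ (they satisfy the same first-order formulas with parameters from $A$). *)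

(* Defs.v *)
From mathcomp Require Import all_boot.
From mathcomp Require Import boolp classical_sets functions cardinality wochoice.

Set Implicit Arguments.
Unset Strict Implicit.
Unset Printing Implicit Defensive.

Local Open Scope classical_set_scope.
Local Open Scope card_scope.

(* Constant symbols are function symbols of arity 0. *)
Record language : Type := Language {
  fsym : Type;
  farity : fsym -> nat;
  rsym : Type;
  rarity : rsym -> nat }.

Definition countable_language (L : language) : Prop :=
  countable [set: fsym L] /\ countable [set: rsym L].

Inductive term (L : language) (V : Type) : Type :=
| Var of V
| App (f : fsym L) of ('I_(farity f) -> term L V).

(* [formula L V] is the type of L-formulas with free variables in V. The
   quantifier binds the variable [None] of [option V]. *)
Inductive formula (L : language) (V : Type) : Type :=
| Bot
| Eq of term L V & term L V
| Rel (r : rsym L) of ('I_(rarity r) -> term L V)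
| Imp of formula L V & formula L V
| All of formula L (option V).

Arguments Bot {L V}.

Definition Not (L : language) (V : Type) (phi : formula L V) : formula L V :=
  Imp phi Bot.

Definition sentence (L : language) : Type := formula L void.

Record fo_structure (L : language) : Type := FoStructure {
  carrier :> Type;
  carrier_inhabited : inhabited carrier;
  finterp : forall f : fsym L, ('I_(farity f) -> carrier) -> carrier;
  rinterp : forall r : rsym L, ('I_(rarity r) -> carrier) -> Prop }.

Fixpoint eval (L : language) (M : fo_structure L) (V : Type) (s : V -> M)
    (t : term L V) : M :=
  match t with
  | Var v => s v
  | App f ts => finterp (fun i => eval s (ts i))
  end.

Fixpoint sat (L : language) (M : fo_structure L) (V : Type)
    (phi : formula L V) : (V -> M) -> Prop :=
  match phi with
  | Bot => fun=> False
  | Eq t u => fun s => eval s t = eval s u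
  | Rel r ts => fun s => rinterp (fun i => eval s (ts i))
  | Imp psi chi => fun s => sat psi s -> sat chi s
  | All psi => fun s => forall m : M, sat psi (fun o => oapp s m o)
  end.

Definition holds (L : language) (M : fo_structure L) (phi : sentence L) : Prop :=
  sat phi (@of_void M).

Definition is_model (L : language) (T : set (sentence L)) (M : fo_structure L)
  : Prop := forall phi, T phi -> holds M phi.

Definition entails (L : language) (T : set (sentence L)) (phi : sentence L)
  : Prop := forall M : fo_structure L, is_model T M -> holds M phi.

Definition complete_theory (L : language) (T : set (sentence L)) : Prop :=
  (exists M : fo_structure L, is_model T M) /\
  (forall phi, entails T phi \/ entails T (Not phi)).

Definition language_with (L : language) (M : fo_structure L) (A : set M)
  : language :=
  @Language (fsym L + set_type A)%type
    (fun f => match f with inl g => farity g | inr _ => 0 end)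
    (rsym L) (@rarity L).

(* M as an L(A)-structure: each new constant names the element it comes from. *)
Definition expansion (L : language) (M : fo_structure L) (A : set M)
  : fo_structure (language_with A) :=
  @FoStructure (language_with A) M (carrier_inhabited M)
    (fun f : fsym (language_with A) =>
       match f return ('I_(@farity (language_with A) f) -> M) -> M with
       | inl g => fun args => @finterp L M g args
       | inr a => fun=> \val a
       end)
    (fun r args => @rinterp L M r args).

(* Complete n-types over A: complete sets of L(A)-formulas in n free variables
   that are finitely satisfiable in M. *)
Definition complete_types (L : language) (M : fo_structure L) (A : set M)
    (n : nat) : set (set (formula (language_with A) 'I_n)) :=
  [set p | (forall q, finite_set q -> q `<=` p ->
              exists s : 'I_n -> M,
                forall phi, q phi -> @sat _ (expansion A) _ phi s) /\
           (forall phi, p phi \/ p (Not phi))].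

Arguments complete_types {L M} A n _.

Definition omega_stable (L : language) (T : set (sentence L)) : Prop :=
  forall M : fo_structure L, is_model T M ->
  forall A : set M, countable A ->
  forall n : nat, countable (complete_types A n).

(* Two n-tuples of d-tuples, read as families indexed by 'I_n * 'I_d, have the
   same complete type over A in M. *)
Definition same_type (L : language) (M : fo_structure L) (A : set M) (n d : nat)
    (a b : 'I_n -> ('I_d -> M)) : Prop :=
  forall phi : formula (language_with A) ('I_n * 'I_d),
    @sat _ (expansion A) _ phi (fun ij => a ij.1 ij.2) <->
    @sat _ (expansion A) _ phi (fun ij => b ij.1 ij.2).

Definition equivalence_on (T : Type) (Y : set T) (E : T -> T -> Prop) : Prop :=
  [/\ forall x, Y x -> E x x,
      forall x y, Y x -> Y y -> E x y -> E y x &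
      forall x y z, Y x -> Y y -> Y z -> E x y -> E y z -> E x z].

Definition eq_class (T : Type) (Y : set T) (E : T -> T -> Prop) (x : T) : set T :=
  [set y | Y y /\ E x y].

Definition eq_classes (T : Type) (Y : set T) (E : T -> T -> Prop)
  : set (set T) := eq_class Y E @` Y.

Definition indiscernible (L : language) (M : fo_structure L) (A : set M)
    (d : nat) (Y : set ('I_d -> M)) (E : ('I_d -> M) -> ('I_d -> M) -> Prop)
  : Prop :=
  forall (n : nat) (a b : 'I_n -> ('I_d -> M)),
    (forall i, Y (a i)) -> (forall i, Y (b i)) ->
    injective a -> injective b ->
    (forall i j : 'I_n, i < j -> (E (a i) (a j) <-> E (b i) (b j))) ->
    same_type A a b.

Definition card_lt (T U : Type) (A : set T) (B : set U) : Prop :=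
  A #<= B /\ ~ (B #<= A).

(* A cardinal is an initial ordinal, presented up to isomorphism: a well-ordered
   type all of whose proper initial segments have smaller cardinality. *)
Record cardinal : Type := Cardinal {
  csort :> Type;
  cle : rel csort;
  cle_wo : well_order cle;
  cle_initial : forall x : csort,
    card_lt [set y | cle y x /\ y <> x] [set: csort] }.

Definition cofinal (kappa : cardinal) (C : set kappa) : Prop :=
  forall x : kappa, exists2 y, C y & cle x y.

Definition is_cof (kappa lambda : cardinal) : Prop :=
  (exists C : set kappa, cofinal C /\ C #= [set: lambda]) /\
  (forall C : set kappa, cofinal C -> [set: lambda] #<= C).

Definition singular (kappa : cardinal) : Prop :=
  infinite_set [set: kappa] /\
  exists2 lambda : cardinal, is_cof kappa lambda &
    card_lt [set: lambda] [set: kappa].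

(* Main.v *)
Require Import Defs.
From mathcomp Require Import all_boot.
From mathcomp Require Import boolp classical_sets functions cardinality.
From mathcomp Require Import filter wochoice.

Set Implicit Arguments.
Unset Strict Implicit.
Unset Printing Implicit Defensive.

Local Open Scope classical_set_scope.
Local Open Scope card_scope.

(** Genericity is measured here by cardinality. Let mu be an infinite cardinal
   below kappa, and call a part of X small when it has at most mu elements. Omega-stability
   forbids infinite binary trees of definable sets ([no_splitting_class]); so
   some definable set with a trace on X that is not small is cut by no definable
   set into two such sets. The sets that contain almost all of this trace form a
   sigma-complete filter p deciding every definable set, which amounts to a type
   over the whole structure ([generic_of_ideal]). A tuple is called typical for p
   over B when it lies in every set of p that is definable over B. If B has at most
   mu elements, almost all tuples of the trace are typical over B
   ([atypical_small]), which allows long sequences of typical tuples.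

   The filter p is controlled by finitely many elements c. Say that a definable
   set has binary rank at least alpha + 1 when a definable set cuts it into two
   sets of rank at least alpha. If S, defined with parameters c, has the least
   rank in p, then a definable P belongs to p exactly when the intersection of S
   and P still has the rank of S, because this intersection and S minus P
   cannot both keep that rank. In a homogeneous structure the rank depends only on
   the type of the parameters, so that filters given by the same formula with
   parameters c and c' of the same type agree when c is replaced by c'
   ([coded_uniform]).
   Ultrapowers by non-principal ultrafilters on the natural numbers are
   homogeneous ([ultrapower_homogeneous]), and the whole construction takes place
   in one of them.

   Generic quantifiers commute ([generic_commute]), for otherwise a formula would
   order an infinite sequence, which omega-stability forbids
   ([no_order_property]). Hence a tuple typical over its predecessors in a
   sequence of such tuples is typical over all the other ones
   ([typical_unordered]), and the type of finitely many of them depends only on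
   the type of the parameters of their filters ([typical_family_equi]).

   It remains to take bounds mu_i, for i in lambda, which are at least lambda,
   do not decrease with i and exhaust kappa ([cof_levels]), and the filters p_i that
   they give. As lambda is regular and uncountable, lambda many p_i are coded by
   the same formula. The method applies to the family of their parameters c_i as
   well, with small meaning smaller than lambda, and leaves lambda many i for
   which the c_i are indiscernible over A ([indiscernible_parameters]). For each
   of these i, a block of mu_i tuples typical for p_i is chosen by transfinite
   recursion; Y is the union of the blocks, and the blocks are the classes of E
   ([generic_blocks]). *)

(** * Renaming, supports and parameters of formulas *)

Fixpoint tren (L : language) (V W : Type) (g : V -> W) (t : term L V) : term L W :=
  match t with
  | Var v => Var L (g v)
  | App f ts => App (fun i => tren g (ts i))
  end.

Fixpoint ren (L : language) (V : Type) (phi : formula L V) :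
    forall W : Type, (V -> W) -> formula L W :=
  match phi with
  | Bot => fun W g => Bot
  | Eq t u => fun W g => Eq (tren g t) (tren g u)
  | Rel r ts => fun W g => Rel (fun i => tren g (ts i))
  | Imp psi chi => fun W g => Imp (ren psi g) (ren chi g)
  | All psi => fun W g => All (ren psi (omap g))
  end.

Lemma eval_tren (L : language) (M : fo_structure L) (V W : Type) (g : V -> W)
    (t : term L V) (s : W -> M) :
  eval s (tren g t) = eval (s \o g) t.
Proof. by elim: t => //= f ts IH; congr finterp; apply/funext. Qed.

Lemma sat_ren (L : language) (M : fo_structure L) (V W : Type) (g : V -> W)
    (phi : formula L V) (s : W -> M) :
  sat (ren phi g) s <-> sat phi (s \o g).
Proof.
elim: phi W g s => {V} [V|V t u|V r ts|V p IHp q IHq|V p IHp] W g s //=.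
- by rewrite !eval_tren.
- by under eq_fun do rewrite eval_tren.
- by split=> H /IHp/H/IHq.
- have E m : oapp s m \o omap g = (fun o => oapp (s \o g) m o).
    by apply/funext => -[].
  by split=> H m; have := H m; rewrite IHp -E.
Qed.

Lemma tren_comp (L : language) (U V W : Type) (f : U -> V) (g : V -> W) (t : term L U) :
  tren g (tren f t) = tren (g \o f) t.
Proof. by elim: t => //= h ts IH; congr App; apply/funext. Qed.

Lemma ren_comp (L : language) (U V W : Type) (f : U -> V) (g : V -> W)
    (phi : formula L U) :
  ren (ren phi f) g = ren phi (g \o f).
Proof.
elim: phi V W f g => {U} [U|U t u|U r ts|U p IHp q IHq|U p IHp] V W f g //=.
- by rewrite !tren_comp.
- by under eq_fun do rewrite tren_comp.
- by rewrite IHp IHq.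
- by rewrite IHp; congr (All (ren _ _)); apply/funext => -[].
Qed.

Lemma tren_id (L : language) (U : Type) (t : term L U) : tren id t = t.
Proof. by elim: t => //= h ts IH; congr App; apply/funext. Qed.

Lemma ren_id (L : language) (U : Type) (phi : formula L U) : ren phi id = phi.
Proof.
elim: phi => {U} [U|U t u|U r ts|U p IHp q IHq|U p IHp] //=.
- by rewrite !tren_id.
- by under eq_fun do rewrite tren_id.
- by rewrite IHp IHq.
- by rewrite -[in RHS]IHp; congr (All (ren _ _)); apply/funext => -[].
Qed.

Fixpoint toccurs (L : language) (V : Type) (v : V) (t : term L V) : Prop :=
  match t with
  | Var w => w = v
  | App f ts => exists i, toccurs v (ts i)
  end.

Fixpoint occurs (L : language) (V : Type) (phi : formula L V) : V -> Prop :=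
  match phi with
  | Bot => fun=> False
  | Eq t u => fun v => toccurs v t \/ toccurs v u
  | Rel r ts => fun v => exists i, toccurs v (ts i)
  | Imp psi chi => fun v => occurs psi v \/ occurs chi v
  | All psi => fun v => occurs psi (Some v)
  end.

Lemma eq_tren (L : language) (V W : Type) (f g : V -> W) (t : term L V) :
  (forall v, toccurs v t -> f v = g v) -> tren f t = tren g t.
Proof.
elim: t => /= [v ->//|h ts IH H]; congr App.
by apply/funext => i; apply: IH => v hv; apply: H; exists i.
Qed.

Lemma eq_ren (L : language) (V W : Type) (f g : V -> W) (phi : formula L V) :
  (forall v, occurs phi v -> f v = g v) -> ren phi f = ren phi g.
Proof.
elim: phi W f g => {V} [V|V t u|V r ts|V p IHp q IHq|V p IHp] W f g //= H.
- by congr Eq; apply: eq_tren => v hv; apply: H; [left|right].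
- congr Rel; apply/funext => i; apply: eq_tren => v hv; apply: H; by exists i.
- by congr Imp; [apply: IHp|apply: IHq] => v hv; apply: H; [left|right].
- congr All; apply: IHp => -[v|] //= hv; congr Some; exact: H.
Qed.

Definition of_ord0 (T : Type) (i : 'I_0) : T := False_rect T (notF (ltn_ord i)).

Definition listed (V : Type) (P : V -> Prop) :=
  exists (n : nat) (l : 'I_n -> V), forall v, P v -> exists i, l i = v.

Lemma listedU (V : Type) (P Q : V -> Prop) :
  listed P -> listed Q -> listed (fun v => P v \/ Q v).
Proof.
move=> [n [l Hl]] [m [k Hk]].
exists (n + m), (fun i : 'I_(n + m) => match fintype.split i with inl i => l i | inr j => k j end).
move=> v [/Hl[i <-]|/Hk[j <-]].
  by exists (unsplit (inl i)); rewrite unsplitK.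
by exists (unsplit (inr j)); rewrite unsplitK.
Qed.

Lemma listed_ord (V : Type) (n : nat) (P : 'I_n -> V -> Prop) :
  (forall i, listed (P i)) -> listed (fun v => exists i, P i v).
Proof.
elim: n P => [|n IH] P HP.
  by exists 0, (@of_ord0 _) => v [[]].
have := listedU (HP ord0) (IH (fun i => P (lift ord0 i)) (fun i => HP _)).
move=> [m [l Hl]]; exists m, l => v [i]; have [j->|->] := unliftP ord0 i => Pi.
  by apply: Hl; right; exists j.
by apply: Hl; left.
Qed.

Lemma listed_toccurs (L : language) (V : Type) (t : term L V) :
  listed (fun v => toccurs v t).
Proof.
elim: t => /= [v|f ts IH]; last exact: listed_ord.
by exists 1, (fun=> v) => w ->; exists ord0.
Qed.

(** A quantified formula is handled by dropping the bound variable [None] from a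
   list that covers the variables of its body. *)
Lemma listed_some (V : Type) (P : option V -> Prop) :
  listed P -> listed (fun v => P (Some v)).
Proof.
case=> n; elim: n P => [|n IH] P [l Hl].
  by exists 0, (@of_ord0 _) => v /Hl[[]].
have [|m [k Hk]] := IH (fun o => P o /\ o <> l ord0).
  exists (l \o lift ord0) => o [/Hl[i <-]].
  by have [j->|->] := unliftP ord0 i => // _; exists j.
case E: (l ord0) => [v0|].
  have : listed (fun v => P (Some v) /\ Some v <> Some v0).
    by exists m, k; rewrite -E.
  have L1 : listed (fun v => v = v0) by exists 1, (fun=> v0) => w ->; exists ord0.
  move=> /(listedU L1)[m' [k' Hk']]; exists m', k' => v Pv; apply: Hk'.
  by have [[->]|ne] := EM (Some v = Some v0); [left|right].
by exists m, k => v Pv; apply: Hk; rewrite E.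
Qed.

Lemma listed_occurs (L : language) (V : Type) (phi : formula L V) :
  listed (occurs phi).
Proof.
elim: phi => {V} [V|V t u|V r ts|V p IHp q IHq|V p IHp] /=.
- by exists 0, (@of_ord0 _).
- by apply: listedU; apply: listed_toccurs.
- by apply: listed_ord => i; apply: listed_toccurs.
- exact: listedU.
- exact: listed_some.
Qed.

(** Renaming depends only on the variables that occur, and the variables of the
   formula have codes in a finite ordinal. *)
Lemma finite_support (L : language) (V : Type) (phi : formula L V) :
  exists (n : nat) (g : 'I_n -> V) (psi : formula L 'I_n), phi = ren psi g.
Proof.
have [n [g Hg]] := listed_occurs phi.
have [[v0]|V0] := EM (inhabited V); last first.
  exists 0, (@of_ord0 _).
  exists (ren phi (fun v => False_rect _ (V0 (inhabits v)))).
  by rewrite ren_comp -[LHS]ren_id; apply: eq_ren => v; case: V0.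
have [g0 Hg0] : exists g0 : 'I_n.+1 -> V,
    forall v, occurs phi v -> exists i, g0 i = v.
  exists (fun i => if unlift ord0 i is Some j then g j else v0) => v.
  by move=> /Hg[i <-]; exists (lift ord0 i); rewrite liftK.
have /choice[h Hh] v : exists i, occurs phi v -> g0 i = v.
  have [/Hg0[i <-]|no] := EM (occurs phi v).
    by exists i.
  by exists ord0.
exists n.+1, g0, (ren phi h); rewrite ren_comp -[LHS]ren_id.
by apply: eq_ren => v /Hh.
Qed.

Definition sum_shift (K V W : Type) (g : V -> W) (v : K + V) : K + W :=
  match v with inl k => inl k | inr v => inr (g v) end.

(** The same with a block [K] of variables kept apart: a formula with parameters
   from [V] uses finitely many of them. *)
Lemma finite_params (L : language) (K V : Type) (phi : formula L (K + V)) :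
  exists (n : nat) (g : 'I_n -> V) (psi : formula L (K + 'I_n)),
    phi = ren psi (sum_shift g).
Proof.
have [n [g [psi ->]]] := finite_support phi.
have [[v0]|V0] := EM (inhabited V); last first.
  exists 0, (@of_ord0 _).
  exists (ren psi (fun i => match g i with inl k => inl k
    | inr v => False_rect _ (V0 (inhabits v)) end)).
  rewrite ren_comp; congr ren; apply/funext => i /=.
  by case: (g i) => // v; case: (V0 (inhabits v)).
exists n, (fun i => match g i with inl _ => v0 | inr v => v end).
exists (ren psi (fun i => match g i with inl k => inl k | inr _ => inr i end)).
rewrite ren_comp; congr ren; apply/funext => i /=.
by case E: (g i) => //=; rewrite E.
Qed.

(** * Countability of the set of formulas *)

(** Comparison of types by injections; the relation [#<=] on sets reduces to it by
   [card_le_embeds]. *)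
Definition embeds (T U : Type) : Prop := exists f : T -> U, injective f.

Lemma embeds_refl (T : Type) : embeds T T.
Proof. by exists id. Qed.

Lemma embeds_trans (T U V : Type) : embeds T U -> embeds U V -> embeds T V.
Proof. by move=> [f fI] [g gI]; exists (g \o f); apply: inj_comp. Qed.

Lemma embeds_option (V : Type) : embeds V nat -> embeds (option V) nat.
Proof.
by move=> [f fI]; exists (oapp (S \o f) 0) => -[x|] [y|] //= [/fI->].
Qed.

Lemma embeds_sum (V W : Type) : embeds V nat -> embeds W nat -> embeds (V + W) nat.
Proof.
move=> [f fI] [g gI].
exists (fun v => pickle (match v with inl v => inl (f v) | inr w => inr (g w) end)).
by move=> [v|w] [v'|w'] /(pcan_inj pickleK) => [[/fI->]|[]|[]|[/gI->]].
Qed.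

Lemma embeds_countType (V : countType) : embeds V nat.
Proof. by exists pickle; apply: pcan_inj pickleK. Qed.

Fixpoint tcode (L : language) (V : Type) (cf : Defs.fsym L -> nat) (g : V -> nat)
    (t : term L V) : GenTree.tree nat :=
  match t with
  | Var v => GenTree.Leaf (g v)
  | App f ts =>
      GenTree.Node (cf f) [seq tcode cf g (ts i) | i <- enum 'I_(farity f)]
  end.

(** The code of the bound variable is 0, and the codes of the other variables are
   shifted, so that the coding of variables stays injective under quantifiers. *)
Fixpoint fcode (L : language) (V : Type) (cf : Defs.fsym L -> nat)
    (cr : rsym L -> nat) (phi : formula L V) : (V -> nat) -> GenTree.tree nat :=
  match phi with
  | Bot => fun=> GenTree.Node 0 [::]
  | Eq t u => fun g => GenTree.Node 1 [:: tcode cf g t; tcode cf g u]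
  | Rel r ts => fun g => GenTree.Node 2
      (GenTree.Leaf (cr r) :: [seq tcode cf g (ts i) | i <- enum 'I_(rarity r)])
  | Imp p q => fun g => GenTree.Node 3 [:: fcode cf cr p g; fcode cf cr q g]
  | All p => fun g => GenTree.Node 4 [:: fcode cf cr p (oapp (S \o g) 0)]
  end.

Lemma map_enum_inj (n : nat) (T : Type) (f g : 'I_n -> T) :
  [seq f i | i <- enum 'I_n] = [seq g i | i <- enum 'I_n] -> f = g.
Proof. by move=> /eq_in_map E; apply/funext => i; apply: E; rewrite mem_enum. Qed.

Lemma tcode_inj (L : language) (V : Type) (cf : Defs.fsym L -> nat) (g : V -> nat) :
  injective cf -> injective g -> injective (tcode cf g).
Proof.
move=> cfI gI; elim=> [v|f ts IH] [w|f' ts'] //=; first by case=> /gI ->.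
case=> /cfI ff'; case: _ / ff' ts' => ts' /map_enum_inj E.
by congr App; apply/funext => i; apply: IH; exact: (congr1 (@^~ i) E).
Qed.

Lemma fcode_inj (L : language) (V : Type) (cf : Defs.fsym L -> nat)
    (cr : rsym L -> nat) (g : V -> nat) :
  injective cf -> injective cr -> injective g ->
  injective (fun phi => fcode cf cr phi g).
Proof.
move=> cfI crI gI phi.
elim: phi g gI => {V} [V|V t u|V r ts|V p IHp q IHq|V p IHp] g gI
  [|t' u'|r' ts'|p' q'|p'] //=.
- by case=> /(tcode_inj cfI gI)-> /(tcode_inj cfI gI)->.
- case=> /crI ff'; case: _ / ff' ts' => ts' /map_enum_inj E.
  congr Rel; apply/funext => i; apply: (tcode_inj cfI gI).
  exact: (congr1 (@^~ i) E).
- by case=> /IHp-> // /IHq->.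
- by case=> /IHp-> // [x|] [y|] //= [/gI->].
Qed.

Lemma countable_embeds (T : Type) : countable [set: T] -> embeds T nat.
Proof. by move=> /pcard_injP[f fI]; exists f => x y; apply: fI; rewrite inE. Qed.

Lemma embeds_countable (T : Type) : embeds T nat -> countable [set: T].
Proof. by move=> [f fI]; apply/pcard_injP; exists f => x y _ _; apply: fI. Qed.

Lemma formula_countable (L : language) (V : Type) :
  countable_language L -> embeds V nat -> embeds (formula L V) nat.
Proof.
move=> [/countable_embeds[cf cfI] /countable_embeds[cr crI]] [g gI].
exists (fun phi => pickle (fcode cf cr phi g)) => x y /(pcan_inj pickleK).
exact: fcode_inj.
Qed.

(** * Constants as variables *)

(** Some variables are replaced by constants naming elements of [C]; together with
   [unconst] below, this exchanges formulas with constants and formulas whose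
   parameters are values of variables. *)
Fixpoint tinst (L : language) (M : fo_structure L) (C : set M) (V W : Type)
    (s : V -> W + set_type C) (t : term L V) : term (language_with C) W :=
  match t with
  | Var v => match s v with
             | inl w => Var _ w
             | inr c => @App (language_with C) W (inr c) (@of_ord0 _)
             end
  | App f ts => @App (language_with C) W (inl f) (fun i => tinst s (ts i))
  end.

Definition lift_inst (V W C : Type) (s : V -> W + C) (o : option V) :
    option W + C :=
  if o is Some v then
    match s v with inl w => inl (Some w) | inr c => inr c end
  else inl None.

Fixpoint inst (L : language) (M : fo_structure L) (C : set M) (V : Type)
    (phi : formula L V) :
    forall W : Type, (V -> W + set_type C) -> formula (language_with C) W :=
  match phi with
  | Bot => fun W s => Bot
  | Eq t u => fun W s => Eq (tinst s t) (tinst s u)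
  | Rel r ts => fun W s => @Rel (language_with C) W r (fun i => tinst s (ts i))
  | Imp psi chi => fun W s => Imp (inst psi s) (inst chi s)
  | All psi => fun W s => All (inst psi (lift_inst s))
  end.

Definition val_inst (M V W : Type) (C : set M) (s : V -> W + set_type C)
  (a : W -> M) (v : V) : M :=
  match s v with inl w => a w | inr c => \val c end.

Lemma eval_tinst (L : language) (M : fo_structure L) (C : set M) (V W : Type)
    (s : V -> W + set_type C) (t : term L V) (a : W -> M) :
  @eval _ (expansion C) _ a (tinst s t) = eval (val_inst s a) t.
Proof.
elim: t => [v|f ts IH] /=; first by rewrite /val_inst; case: (s v).
by congr finterp; apply/funext.
Qed.

Lemma sat_inst (L : language) (M : fo_structure L) (C : set M) (V W : Type)
    (s : V -> W + set_type C) (phi : formula L V) (a : W -> M) :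
  @sat _ (expansion C) _ (inst phi s) a <-> sat phi (val_inst s a).
Proof.
elim: phi W s a => {V} [V|V t u|V r ts|V p IHp q IHq|V p IHp] W s a //=.
- by rewrite !eval_tinst.
- by under eq_fun do rewrite eval_tinst.
- by split=> H /IHp/H/IHq.
- have E m : val_inst (lift_inst s) (fun o => oapp a m o) =
             (fun o => oapp (val_inst s a) m o).
    by apply/funext => -[v|] //=; rewrite /val_inst /=; case: (s v).
  by split=> H m; have := H m; rewrite IHp E.
Qed.

Fixpoint tunconst (L : language) (M : fo_structure L) (C : set M) (V W : Type)
    (g : V -> W) (h : set_type C -> W) (t : term (language_with C) V) : term L W :=
  match t with
  | Var v => Var L (g v)
  | App f ts =>
      match f return ('I_(@farity (language_with C) f) -> term L W) -> term L W with
      | inl f => fun us => @App L W f us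
      | inr c => fun=> Var L (h c)
      end (fun i => tunconst g h (ts i))
  end.

Fixpoint unconst (L : language) (M : fo_structure L) (C : set M) (V : Type)
    (phi : formula (language_with C) V) :
    forall W : Type, (V -> W) -> (set_type C -> W) -> formula L W :=
  match phi with
  | Bot => fun W g h => Bot
  | Eq t u => fun W g h => Eq (tunconst g h t) (tunconst g h u)
  | Rel r ts => fun W g h => @Rel L W r (fun i => tunconst g h (ts i))
  | Imp psi chi => fun W g h => Imp (unconst psi g h) (unconst chi g h)
  | All psi => fun W g h => All (unconst psi (omap g) (Some \o h))
  end.

Lemma eval_tunconst (L : language) (M : fo_structure L) (C : set M) (V W : Type)
    (g : V -> W) (h : set_type C -> W) (t : term (language_with C) V) (a : W -> M) :
  (forall c, a (h c) = \val c) ->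
  eval a (tunconst g h t) = @eval _ (expansion C) _ (a \o g) t.
Proof.
move=> ah; elim: t => [v|[f|c] ts IH] //=.
by congr finterp; apply/funext.
Qed.

Lemma sat_unconst (L : language) (M : fo_structure L) (C : set M) (V W : Type)
    (g : V -> W) (h : set_type C -> W) (phi : formula (language_with C) V)
    (a : W -> M) :
  (forall c, a (h c) = \val c) ->
  sat (unconst phi g h) a <-> @sat _ (expansion C) _ phi (a \o g).
Proof.
elim: phi W g h a => {V} [V|V t u|V r ts|V p IHp q IHq|V p IHp] W g h a ah //=.
- by rewrite !eval_tunconst.
- have E : (fun i => eval a (tunconst g h (ts i))) =
      (fun i => @eval _ (expansion C) _ (a \o g) (ts i)).
    by apply/funext => i; apply: eval_tunconst.
  by split; rewrite E.
- have := IHp _ g h a ah; have := IHq _ g h a ah; tauto.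
- have E m : oapp a m \o omap g = (fun o => oapp (a \o g) m o).
    by apply/funext => -[].
  by split=> H m; have := H m; rewrite -E IHp.
Qed.

Definition And (L : language) (V : Type) (p q : formula L V) : formula L V :=
  Not (Imp p (Not q)).

Lemma satA (L : language) (M : fo_structure L) (V : Type) (p q : formula L V)
  (s : V -> M) : sat (And p q) s <-> sat p s /\ sat q s.
Proof.
rewrite /And /=; split=> [H|[? ?] H]; last exact: H.
by have [?|?] := EM (sat p s); have [?|?] := EM (sat q s); tauto.
Qed.

(** * Ultrapowers *)

Lemma filter_forall_set (T : Type) (I : finType) (F : set (set T)) {FF : Filter F}
    (P : I -> set T) :
  (forall i, F (P i)) -> F [set x | forall i, P i x].
Proof. by apply: filter_forall. Qed.

Lemma ultraN (T : Type) (U : set (set T)) (A : set T) :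
  UltraFilter U -> U (~` A) <-> ~ U A.
Proof.
move=> UU; split=> [UnA UA|nUA].
  by have [x []] := filter_ex (filterI UA UnA).
by have [] := in_ultra_setVsetC A UU.
Qed.

Section Ultrapower.
Variables (L : language) (M : fo_structure L) (U : set (set nat)).
Hypothesis UU : UltraFilter U.

Definition ueq (f g : nat -> M) : Prop := U [set k | f k = g k].

(** A point of the ultrapower is a class of sequences, encoded as a set. *)
Definition upoint : Type := {c : set (nat -> M) | exists f, c = ueq f}.

Definition upi (f : nat -> M) : upoint := exist _ (ueq f) (ex_intro _ f erefl).

Definition urepr (c : upoint) : nat -> M := projT1 (cid (proj2_sig c)).

Lemma upi_eq (f g : nat -> M) : upi f = upi g <-> ueq f g.
Proof.
split=> [[E]|fg].
  have : ueq g g by apply: filterS filterT => k.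
  by rewrite -E.
apply: eq_exist; apply/funext => h; apply/propext; split => H.
  by apply: filterS (filterI fg H) => k [/= -> ->].
by apply: filterS (filterI fg H) => k [/= -> ->].
Qed.

Lemma upi_repr (c : upoint) : upi (urepr c) = c.
Proof.
rewrite /urepr; case: cid => f /= cf; case: c cf => c e /= cf.
exact: eq_exist.
Qed.

Lemma urepr_pi (f : nat -> M) : U [set k | urepr (upi f) k = f k].
Proof. by apply/upi_eq; rewrite upi_repr. Qed.

Definition ultrapower : fo_structure L :=
  @FoStructure L upoint
    (let: inhabits m := carrier_inhabited M in inhabits (upi (fun=> m)))
    (fun f args => upi (fun k => finterp (fun i : 'I_(farity f) => urepr (args i) k)))
    (fun r args => U [set k | rinterp (fun i : 'I_(rarity r) => urepr (args i) k)]).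

Lemma eval_ultrapower (V : Type) (s : V -> nat -> M) (t : term L V) :
  @eval L ultrapower V (fun v => upi (s v)) t =
  upi (fun k => eval (fun v => s v k) t).
Proof.
elim: t => //= f ts IH; apply/upi_eq.
have H : U [set k | forall i, urepr (upi (fun k => eval (fun v => s v k) (ts i))) k
                              = eval (fun v => s v k) (ts i)].
  by apply: filter_forall_set => i; apply: urepr_pi.
rewrite /ueq; apply: filterS H => k /= H; congr finterp; apply/funext => i.
by rewrite IH H.
Qed.

(** The two steps that need care are implication, where the ultrafilter property is
   used, and quantification, where a counterexample is chosen in each
   coordinate. *)
Theorem Los (V : Type) (phi : formula L V) (s : V -> nat -> M) :
  @sat L ultrapower V phi (fun v => upi (s v)) <->
  U [set k | sat phi (fun v => s v k)].
Proof.
elim: phi s => {V} [V|V t u|V r ts|V p IHp q IHq|V p IHp] s /=.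
- split=> // /filter_ex[x //].
- by rewrite !eval_ultrapower; exact: upi_eq.
- have E : U [set k | forall i, urepr (@eval L ultrapower V (fun v => upi (s v)) (ts i)) k
                       = eval (fun v => s v k) (ts i)].
    by apply: filter_forall_set => i; rewrite eval_ultrapower; apply: urepr_pi.
  split=> H; apply: filterS (filterI E H) => k [/= + +].
    by move=> /funext ->.
  by move=> /funext <-.
- rewrite IHp IHq; split=> [H|H Up]; last first.
    by apply: filterS (filterI H Up) => k [/= + +]; apply.
  have [Up|nUp] := EM (U [set k | sat p (fun v => s v k)]).
    by apply: filterS (H Up) => k /= qk _.
  move/(ultraN _ UU): nUp; apply: filterS => k /= np sp.
  by case: np.
- split=> [H|H m].
    apply: contrapT => /(ultraN _ UU) nU.
    have [m0] := carrier_inhabited M.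
    have /choice[f Hf] k : exists m, (exists m, ~ sat p (fun o => oapp (s^~ k) m o)) ->
        ~ sat p (fun o => oapp (s^~ k) m o).
      have [[m Hm]|no] := EM (exists m, ~ sat p (fun o => oapp (s^~ k) m o)).
        by exists m.
      by exists m0 => /no.
    have := H (upi f).
    have -> : (fun o => oapp (fun v => upi (s v)) (upi f) o) =
              (fun o => upi (oapp s f o)) :> (option V -> ultrapower).
      by apply/funext => -[].
    move/IHp => Up.
    have [k [/= + nk]] := filter_ex (filterI Up nU).
    have -> : (fun o => oapp s f o k) = (fun o => oapp (s^~ k) (f k) o).
      by apply/funext => -[].
    by apply/Hf/existsNP.
  have -> : (fun o => oapp (fun v => upi (s v)) m o) =
            (fun o => upi (oapp s (urepr m) o)) :> (option V -> ultrapower).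
    by apply/funext => -[v|] //=; rewrite upi_repr.
  apply/IHp; apply: filterS H => k /= /(_ (urepr m k)).
  by congr sat; apply/funext => -[].
Qed.

Lemma ultrapower_diag (V : Type) (phi : formula L V) (s : V -> M) :
  @sat L ultrapower V phi (fun v => upi (fun=> s v)) <-> sat phi s.
Proof.
rewrite Los; split=> [/filter_ex[_ //]|H].
by apply: filterS filterT => k.
Qed.

Lemma ultrapower_model (T : set (sentence L)) : is_model T M -> is_model T ultrapower.
Proof.
move=> MT phi /MT; rewrite /holds -ultrapower_diag.
by congr sat; apply/funext => -[].
Qed.

End Ultrapower.

(** * Homogeneity of ultrapowers *)

Definition equi (L : language) (M : fo_structure L) (V : Type) (a b : V -> M) : Prop :=
  forall phi : formula L V, sat phi a <-> sat phi b.

Definition homogeneous (L : language) (M : fo_structure L) : Prop :=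
  forall (V : Type) (a b : V -> M) (m : M), embeds V nat -> equi a b ->
  exists m', equi (fun o => oapp a m o) (fun o => oapp b m' o).

Lemma satE (L : language) (M : fo_structure L) (V : Type)
    (phi : formula L (option V)) (s : V -> M) :
  sat (Not (All (Not phi))) s <-> exists m, sat phi (fun o => oapp s m o).
Proof.
split=> /= [H|[m Hm] H]; last exact: H Hm.
by apply: contrapT => no; apply: H => m Hm; apply: no; exists m.
Qed.

Fixpoint bigand (L : language) (V : Type) (p : nat -> formula L V) (n : nat) :=
  if n is n'.+1 then And (bigand p n') (p n) else p 0.

Lemma bigandP (L : language) (M : fo_structure L) (V : Type)
    (p : nat -> formula L V) (n : nat) (s : V -> M) :
  sat (bigand p n) s <-> forall i, i <= n -> sat (p i) s.
Proof.
elim: n => [|n IH]; first by split=> [H [|i]//|]; apply.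
change (sat (And (bigand p n) (p n.+1)) s <-> forall i, i <= n.+1 -> sat (p i) s).
rewrite satA IH; split=> [[H H'] i|H].
  by rewrite leq_eqVlt => /predU1P[->//|]; apply: H.
by split=> [i le_in|]; apply: H => //; apply: leqW.
Qed.

(** If [(a, m)] satisfies the formulas [chi 0, chi 1, ...], then each finite
   conjunction of them is satisfiable over [b] in almost all coordinates. In
   coordinate [k], the new element satisfies the longest conjunction of index at
   most [k] that is satisfiable there; each [chi n] then holds in almost all
   coordinates. *)
Lemma ultrapower_homogeneous (L : language) (M : fo_structure L)
    (U : set (set nat)) (UU : UltraFilter U) :
  countable_language L -> (forall n, U [set k | n <= k]) ->
  homogeneous (ultrapower M U).
Proof.
move=> cL Uoo V a b m Vnat ab.
have [code codeI] := formula_countable cL (embeds_option Vnat).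
pose dec n : formula L (option V) :=
  if pselect (exists phi, code phi = n) is left H then projT1 (cid H) else Bot.
have decK phi : dec (code phi) = phi.
  rewrite /dec; case: pselect => [H|[]]; last by exists phi.
  by case: cid => psi /= /codeI.
set am : option V -> ultrapower M U := fun o => oapp a m o.
(* dec enumerates all formulas, and chi n is the one of dec n and its negation that
   holds at (a, m) *)
pose chi n := if `[< sat (dec n) am >] then dec n else Not (dec n).
have chi_am n : sat (chi n) am.
  by rewrite /chi; case: asboolP.
pose P n k := exists m, sat (bigand chi n) (fun o => oapp (fun v => urepr (b v) k) m o).
have bE : b = (fun v => upi U (urepr (b v))) by apply/funext => v; rewrite upi_repr.
have UP n : U [set k | P n k].
  have : sat (Not (All (Not (bigand chi n)))) b.
    by apply/ab/satE; exists m; apply/bigandP.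
  rewrite bE => H; have {H} := (Los UU _ _).1 H.
  by apply: filterS => k; rewrite /mkset satE => -[x Hx]; exists x.
have [m0] := carrier_inhabited M.
have Pch k K : exists x, forall n, n <= K -> P n k ->
    sat (bigand chi n) (fun o => oapp (fun v => urepr (b v) k) x o).
  elim: K => [|K [x Hx]].
    have [[x Hx]|no] := EM (P 0 k); first by exists x => -[].
    by exists m0 => -[].
  have [[y /bigandP Hy]|no] := EM (P K.+1 k).
    by exists y => n nK _; apply/bigandP => i le_in; apply: Hy; apply: leq_trans nK.
  exists x => n; rewrite leq_eqVlt => /predU1P[-> //|]; exact: Hx.
have /choice[x Hx] k := Pch k k.
exists (upi U x).
have E : (fun o => oapp b (upi U x) o) =
    (fun o => upi U (oapp (fun v => urepr (b v)) x o)) :> (option V -> ultrapower M U).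
  by apply/funext => -[v|] //=; rewrite upi_repr.
have satchi n : sat (chi n) (fun o => oapp b (upi U x) o).
  have : U [set k | sat (bigand chi n) (fun o => oapp (fun v => urepr (b v)) x o k)].
    apply: filterS (filterI (Uoo n) (UP n)) => k [/= nk /(Hx k n nk)].
    by congr sat; apply/funext => -[].
  by move/Los; rewrite E => /bigandP; apply.
move=> phi; have := satchi (code phi); rewrite /chi decK.
by case: asboolP => /= H H'; split=> // /H'.
Qed.

(** * Types over countable sets *)

Definition sumf (K V M : Type) (x : K -> M) (e : V -> M) (v : K + V) : M :=
  match v with inl k => x k | inr w => e w end.

Definition dset (L : language) (M : fo_structure L) (K V : Type)
  (phi : formula L (K + V)) (e : V -> M) : set (K -> M) := [set x | sat phi (sumf x e)].

(** Cantor's diagonal argument. *)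
Lemma Cantor_bool (f : (nat -> bool) -> nat) : ~ injective f.
Proof.
move=> fI; pose b0 n := `[< exists b, f b = n /\ ~~ b n >].
case E: (b0 (f b0)); last first.
  by move/asboolP: (E); apply; exists b0; split=> //; apply/negbT.
by move/asboolP: (E) => [b [/fI-> ]]; rewrite E.
Qed.

(** Omega-stability in the form in which it is used: continuum many ultrafilters
   cannot be separated by the sets definable over a countable set. *)
Lemma stable_collision (L : language) (T : set (sentence L)) (M : fo_structure L)
    (d : nat) (W : Type) (c : W -> M) (F : (nat -> bool) -> set (set ('I_d -> M))) :
  omega_stable T -> is_model T M -> embeds W nat ->
  (forall b, UltraFilter (F b)) ->
  exists b b', b <> b' /\
    forall phi : formula L ('I_d + W), F b (dset phi c) <-> F b' (dset phi c).
Proof.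
move=> st MT Wnat FU.
pose C := range c.
have cC : countable C.
  apply: card_le_trans (card_image_le _ _) _; exact: embeds_countable.
pose tp b : set (formula (language_with C) 'I_d) :=
  [set phi | F b [set x | @sat _ (expansion C) _ phi x]].
have tpP b : complete_types C d (tp b).
  split=> [q qfin qtp|phi].
    have : F b [set x | forall phi, q phi -> @sat _ (expansion C) _ phi x].
      have /finite_setP[n] := qfin.
      rewrite card_eq_sym => /card_bijP[g].
      have gq (i : `I_n) : q (val (g i)) by apply: set_valP.
      move=> gbij.
      have : F b [set x | forall i : 'I_n, 
          @sat _ (expansion C) _ (val (g (SigSub (mem_set (ltn_ord i : `I_n i))))) x].
        by apply: filter_forall_set => i; apply: qtp; apply: gq.
      apply: filterS => x Hx phi qphi.
      have [h _ hK] := gbij.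
      have := hK (SigSub (mem_set qphi)); case: (h _) => i iP E.
      have := Hx (Ordinal (set_mem iP)).
      by rewrite (Prop_irrelevance (mem_set _) iP) E.
    by move=> /filter_ex[x Hx]; exists x.
  have [|] := in_ultra_setVsetC [set x | @sat _ (expansion C) _ phi x] (FU b); first by left.
  by right.
apply: contrapT => no.
have tpI : injective tp.
  move=> b b' bb'; apply: contrapT => ne; apply: no; exists b, b'; split=> // phi.
  have mC w : C (c w) by exists w.
  pose s (v : 'I_d + W) : 'I_d + set_type C :=
    match v with inl i => inl i | inr w => inr (SigSub (mem_set (mC w))) end.
  have E : dset phi c = [set x | @sat _ (expansion C) _ (inst phi s) x].
    apply/funext => x; apply/propext; rewrite /dset /= sat_inst.
    by have -> : val_inst s x = sumf x c by apply/funext => -[].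
  rewrite E; change (tp b (inst phi s) <-> tp b' (inst phi s)).
  by rewrite bb'.
have /pcard_injP[g gI] := st M MT C cC d.
apply: (@Cantor_bool (g \o tp)) => b b' /gI.
by move=> /(_ (mem_set (tpP b)) (mem_set (tpP b')))/tpI.
Qed.

Lemma nonprincipal_ultrafilter :
  exists U : set (set nat), UltraFilter U /\ forall n, U [set k | n <= k].
Proof.
have [U [UU ooU]] := ultraFilterLemma eventually_filter.
by exists U; split=> // n; apply: ooU; exists n.
Qed.

(** * No order property *)

Lemma first_difference (b c : nat -> bool) :
  b <> c -> exists2 j, b j != c j & forall i, i < j -> b i = c i.
Proof.
move=> ne; have ex : exists i, b i != c i.
  apply: contrapT => no; apply: ne; apply/funext => i; apply/eqP/negP => /negP H.
  by apply: no; exists i.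
have [j bj jmin] := ex_minnP ex; exists j => // k kj; apply/eqP.
by apply: contraTT kj => /jmin; rewrite -leqNgt.
Qed.

(** The number with [k] binary digits [b 0, b 1, ...], the leading one being
   [b 0]: an approximation of the real number with these digits. *)
Fixpoint bval (b : nat -> bool) (k : nat) : nat :=
  if k is k'.+1 then (bval b k').*2 + b k' else 0.

Lemma bval_le (b c : nat -> bool) (j k : nat) :
  (forall i, i <= j -> b i = c i) -> (forall i, j < i -> c i) -> bval b k <= bval c k.
Proof.
move=> bc ct; elim: k => //= k IH.
apply: leq_add; first by rewrite leq_double.
by have [/bc->//|/ct->] := leqP k j; case: (b k).
Qed.

Lemma bval_lt (b c : nat -> bool) (j k : nat) :
  (forall i, i < j -> b i = c i) -> b j = false -> c j -> j < k -> bval b k < bval c k.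
Proof.
move=> bc bj cj; elim: k => // k IH; rewrite ltnS leq_eqVlt => /predU1P[<-|/IH{}IH] /=.
  rewrite bj cj addn0 addn1 ltnS leq_double leq_eqVlt; apply/orP; left; apply/eqP.
  elim: j bc {IH bj cj} => //= j IH bc; rewrite IH ?bc // => i ij.
  by apply: bc; apply: ltnW.
have : (bval b k).+1.*2 <= (bval c k).*2 by rewrite leq_double.
rewrite doubleS => H; apply: leq_trans (leq_addr _ _).
by apply: leq_trans H; rewrite ltnS; case: (b k); rewrite ?addn1 ?addn0.
Qed.

(** If [phi] ordered two sequences, the elements of an ultrapower whose
   coordinates run through the binary approximations of a real number would
   realise continuum many types over the countable set of those coming from the
   numbers whose digits are eventually 1. *)
Lemma no_order_property (L : language) (T : set (sentence L)) (M : fo_structure L)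
    (d m : nat) (phi : formula L (('I_d + 'I_d) + 'I_m)) (e : 'I_m -> M)
    (u v : nat -> 'I_d -> M) :
  omega_stable T -> is_model T M ->
  ~ (forall k n, sat phi (sumf (sumf (u k) (v n)) e) <-> k <= n).
Proof.
move=> st MT ord.
have [U [UU Uoo]] := nonprincipal_ultrafilter.
have NT := ultrapower_model UU MT.
pose N := ultrapower M U.
pose ev (l : seq bool) : nat -> bool := nth true l.
pose x b (i : 'I_d) : N := upi U (fun k => u (bval b k) i).
pose y b (i : 'I_d) : N := upi U (fun k => v (bval b k) i).
pose W : Type := (seq bool * 'I_d + 'I_m)%type.
pose c (w : W) : N :=
  match w with inl p => y (ev p.1) p.2 | inr i => upi U (fun=> e i) end.
have Wnat : embeds W nat by exists pickle; apply: pcan_inj pickleK.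
have [b [b' [ne bb']]] := stable_collision c st NT Wnat
  (fun b => principal_filter_ultra (x b)).
have {}bb' psi : dset psi c (x b) <-> dset psi c (x b').
  by have := bb' psi; rewrite !principal_filterP.
have key b1 b2 j : (forall i, i < j -> b1 i = b2 i) -> b1 j = false -> b2 j ->
    ~ forall psi : formula L ('I_d + W), dset psi c (x b1) <-> dset psi c (x b2).
  move=> b12 b1j b2j H.
  (* The digits of b1 up to j, followed by ones, give a number between b1 and b2. *)
  pose l := mkseq b1 j.+1.
  have lE i : i <= j -> ev l i = b1 i by move=> ij; rewrite /ev nth_mkseq.
  have lT i : j < i -> ev l i by move=> ij; rewrite /ev nth_default // size_mkseq.
  pose g (w : ('I_d + 'I_d) + 'I_m) : 'I_d + W :=
    match w with
    | inl (inl i) => inl i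
    | inl (inr i) => inr (inl (l, i))
    | inr i => inr (inr i)
    end.
  have sx b3 : dset (ren phi g) c (x b3) <->
      U [set k | bval b3 k <= bval (ev l) k].
    rewrite /dset /= sat_ren.
    have -> : sumf (x b3) c \o g = (fun w => upi U (fun k =>
        sumf (sumf (u (bval b3 k)) (v (bval (ev l) k))) e w)).
      by apply/funext => -[[i|i]|i].
    rewrite Los; split; apply: filterS => k /=; by rewrite ord.
  have : U [set k | bval b1 k <= bval (ev l) k].
    apply: filterS filterT => k _ /=.
    by apply: (@bval_le _ _ j) => // i /lE.
  move=> /sx/H/sx H1.
  have [k [/= kj]] := filter_ex (filterI (Uoo j.+1) H1).
  rewrite leqNgt => /negP; apply.
  apply: (@bval_lt _ _ j) => //; last by rewrite lE.
  by move=> i ij; rewrite lE ?b12 // ltnW.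
have [j bj bmin] := first_difference ne.
case E: (b j) bj; case E': (b' j) => // _.
  by apply: (@key b' b j) => // [i /bmin->//|psi]; rewrite -bb'.
by apply: (@key b b' j) => //.
Qed.

(** * Definable sets and binary trees *)

Definition definable (L : language) (M : fo_structure L) (d : nat)
    (S : set ('I_d -> M)) : Prop :=
  exists (n : nat) (phi : formula L ('I_d + 'I_n)) (e : 'I_n -> M), S = dset phi e.

Lemma dset_ren (L : language) (M : fo_structure L) (d : nat) (V W : Type)
    (g : V -> W) (phi : formula L ('I_d + V)) (e : W -> M) :
  dset (ren phi (sum_shift g)) e = dset phi (e \o g).
Proof.
apply/funext => x; apply/propext; rewrite /dset /= sat_ren.
by have -> : sumf x e \o sum_shift g = sumf x (e \o g) by apply/funext => -[].
Qed.

Lemma definable_dset (L : language) (M : fo_structure L) (d : nat) (V : Type)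
    (phi : formula L ('I_d + V)) (e : V -> M) :
  definable (dset phi e).
Proof.
have [n [g [psi ->]]] := finite_params phi.
by exists n, psi, (e \o g); rewrite dset_ren.
Qed.

Lemma dsetI (L : language) (M : fo_structure L) (d : nat) (V W : Type)
    (phi : formula L ('I_d + V)) (psi : formula L ('I_d + W)) (a : V -> M) (b : W -> M) :
  dset phi a `&` dset psi b =
  dset (And (ren phi (sum_shift inl)) (ren psi (sum_shift inr))) (sumf a b).
Proof.
have -> : dset phi a = dset (ren phi (sum_shift inl)) (sumf a b) by rewrite dset_ren.
have -> : dset psi b = dset (ren psi (sum_shift inr)) (sumf a b) by rewrite dset_ren.
by apply/funext => x; apply/propext; rewrite /dset /mkset satA.
Qed.

Lemma dsetD (L : language) (M : fo_structure L) (d : nat) (V W : Type)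
    (phi : formula L ('I_d + V)) (psi : formula L ('I_d + W)) (a : V -> M) (b : W -> M) :
  dset phi a `\` dset psi b =
  dset (And (ren phi (sum_shift inl)) (ren (Not psi) (sum_shift inr))) (sumf a b).
Proof. by rewrite -dsetI. Qed.

Lemma definableI (L : language) (M : fo_structure L) (d : nat) (A B : set ('I_d -> M)) :
  definable A -> definable B -> definable (A `&` B).
Proof.
by move=> [n [phi [a ->]]] [m [psi [b ->]]]; rewrite dsetI; apply: definable_dset.
Qed.

Lemma definableC (L : language) (M : fo_structure L) (d : nat) (A : set ('I_d -> M)) :
  definable A -> definable (~` A).
Proof. by move=> [n [phi [a ->]]]; exists n, (Not phi), a. Qed.

Lemma definableD (L : language) (M : fo_structure L) (d : nat) (A B : set ('I_d -> M)) :
  definable A -> definable B -> definable (A `\` B).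
Proof. by move=> dA dB; rewrite setDE; apply: definableI => //; apply: definableC. Qed.

Lemma definableT (L : language) (M : fo_structure L) (d : nat) :
  definable [set: 'I_d -> M].
Proof.
have [m0] := carrier_inhabited M.
suff -> : [set: 'I_d -> M] = dset (@Not L ('I_d + unit) Bot) (fun=> m0).
  exact: definable_dset.
by apply/funext => x; apply/propext; split=> // _; apply.
Qed.

(** Splitting a set for ever inside [D] grows a binary tree of definable sets;
   its countably many parameters separate its continuum many branches. *)
Lemma no_splitting_class (L : language) (T : set (sentence L)) (M : fo_structure L)
    (d : nat) (D : set (set ('I_d -> M))) :
  omega_stable T -> is_model T M ->
  (forall S, D S -> S !=set0) ->
  (forall S, D S -> exists P, [/\ definable P, D (S `&` P) & D (S `\` P)]) ->
  forall S, ~ D S.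
Proof.
move=> st MT D0 Dsplit S0 DS0.
pose code := {n : nat & (formula L ('I_d + 'I_n) * ('I_n -> M))%type}.
pose den (p : code) := dset (projT2 p).1 (projT2 p).2.
have [m0] := carrier_inhabited M.
have /choice[f Hf] S : exists p : code, D S -> D (S `&` den p) /\ D (S `\` den p).
  have [DS|nDS] := EM (D S); last first.
    by exists (existT _ 0 (Bot, fun=> m0)) => /nDS.
  have [P [[n [phi [e ->]]] D1 D2]] := Dsplit S DS.
  by exists (existT _ n (phi, e)).
pose node (l : seq bool) : set ('I_d -> M) :=
  foldl (fun (S : set ('I_d -> M)) (b : bool) =>
    if b then S `&` den (f S) else S `\` den (f S)) S0 l.
have nodeS l b : node (rcons l b) =
    (if b then node l `&` den (f (node l)) else node l `\` den (f (node l))).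
  by rewrite /node foldl_rcons.
have Dnode l : D (node l).
  elim/last_ind: l => [//|l b IH]; rewrite nodeS.
  by have [D1 D2] := Hf _ IH; case: b.
have node_dec (b : nat -> bool) k k' : k <= k' -> node (mkseq b k') `<=` node (mkseq b k).
  elim: k' => [|k' IH]; first by rewrite leqn0 => /eqP ->.
  rewrite leq_eqVlt => /predU1P[-> //|/IH]; apply: subset_trans.
  by rewrite mkseqS nodeS; case: ifP => _ x [].
have /choice[F HF] b : exists U : set (set ('I_d -> M)),
    UltraFilter U /\ forall k, U (node (mkseq b k)).
  have pF : ProperFilter (filter_from setT (fun k => node (mkseq b k))).
    apply: filter_from_proper; last by move=> k _; apply: D0.
    apply: filter_from_filter; first by exists 0.
    move=> i j _ _; exists (maxn i j) => // x Hx.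
    by split; apply: node_dec Hx; rewrite ?leq_maxl ?leq_maxr.
  have [U [UU sU]] := ultraFilterLemma pF.
  by exists U; split=> // k; apply: sU; exists k.
pose W := {l : seq bool & 'I_(projT1 (f (node l)))}.
pose c (w : W) : M := (projT2 (f (node (projT1 w)))).2 (projT2 w).
have Wnat : embeds W nat by exists pickle; apply: pcan_inj pickleK.
have [b [b' [ne bb']]] := stable_collision c st MT Wnat (fun b => (HF b).1).
have [j bj bmin] := first_difference ne.
pose l := mkseq b j.
have lE : mkseq b' j = l.
  by apply/eq_in_map => i; rewrite mem_iota /= => /bmin.
have [psi psiE] : exists psi : formula L ('I_d + W), dset psi c = den (f (node l)).
  exists (ren (projT2 (f (node l))).1 (sum_shift (fun i => existT _ l i : W))).
  by rewrite dset_ren.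
have inF b0 : mkseq b0 j = l -> F b0 (dset psi c) <-> b0 j.
  move=> l0; have [FU /(_ j.+1)] := HF b0.
  rewrite mkseqS l0 nodeS psiE => Fn; split=> [Fd|b0j]; last first.
    by rewrite b0j in Fn; apply: filterS Fn => x [].
  by apply/negPn/negP => /negbTE E; rewrite E in Fn; have [x [? []]] := filter_ex (filterI Fd Fn).
have := bb' psi; rewrite !inF // => E; move: bj.
by case: (b j) E; case: (b' j) => // -[h1 h2]; [have := h1 isT|have := h2 isT].
Qed.

(** * Binary rank *)

(** The predicates in [rank_class] are the families of definable sets of binary
   rank at least alpha, for all ordinals alpha: [split_class] is the successor
   step, and [meet_class] the limit step, as well as the first step when [F] is
   empty. Generating them inductively dispenses with ordinals. *)
Definition split_class (L : language) (M : fo_structure L) (d : nat)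
    (D : set (set ('I_d -> M))) : set (set ('I_d -> M)) :=
  [set S | D S /\ exists P, [/\ definable P, D (S `&` P) & D (S `\` P)]].

Definition meet_class (L : language) (M : fo_structure L) (d : nat)
    (F : set (set (set ('I_d -> M)))) : set (set ('I_d -> M)) :=
  [set S | [/\ definable S, S !=set0 & forall D, F D -> D S]].

Inductive rank_class (L : language) (M : fo_structure L) (d : nat) :
    set (set ('I_d -> M)) -> Prop :=
| rank_split D : rank_class D -> rank_class (split_class D)
| rank_meet (F : set (set (set ('I_d -> M)))) :
    (forall D, F D -> rank_class D) -> rank_class (meet_class F).

Section Rank.
Variables (L : language) (M : fo_structure L) (d : nat).
Implicit Types (D : set (set ('I_d -> M))) (S P : set ('I_d -> M)).

Lemma split_class_sub D : split_class D `<=` D.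
Proof. by move=> S []. Qed.

Lemma rank_class_definable D S : rank_class D -> D S -> definable S /\ S !=set0.
Proof.
by move=> RD; elim: RD S => [D' _ IH S [/IH]|F _ _ S []].
Qed.

(** No rank lies strictly between those of [D] and of [split_class D]. As in the
   proof of Zermelo's theorem, this is shown for a [D] already known to be
   comparable with all classes. *)
Lemma rank_class_step D D' :
  rank_class D -> rank_class D' ->
  (forall D', rank_class D' -> D `<=` split_class D' \/ D' `<=` D) ->
  D' `<=` D -> D' = D \/ D' `<=` split_class D.
Proof.
move=> RD RD' IHD; elim: RD' => {D'} [D' RD' IH|F RF IH] sD.
  have [DD'|D'D] := IHD _ RD'; first by left; apply/seteqP.
  have [->|D'S] := IH D'D; first by right.
  by right; apply: subset_trans D'S; apply: split_class_sub.
have [[D' [FD' D'S]]|no] := EM (exists D', F D' /\ D' `<=` split_class D).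
  by right => S [_ _ /(_ _ FD')/D'S].
left; apply/seteqP; split=> // S DS.
have [dS S0] := rank_class_definable RD DS; split=> // D' FD'.
have [|D'D] := IHD _ (RF _ FD'); first by move=> /(_ _ DS)/split_class_sub.
have [-> //|D'S] := IH _ FD' D'D.
by case: no; exists D'.
Qed.

Lemma rank_class_total D D' :
  rank_class D -> rank_class D' -> D `<=` split_class D' \/ D' `<=` D.
Proof.
move=> RD; elim: RD D' => {D} [D RD IH|F RF IH] D' RD'.
  have [DD'|D'D] := IH _ RD'.
    by left; apply: subset_trans DD'; apply: split_class_sub.
  have [->|?] := rank_class_step RD RD' IH D'D; [by left|by right].
have [[D [FD DD']]|no] := EM (exists D, F D /\ D `<=` split_class D').
  by left => S [_ _ /(_ _ FD)/DD'].
right=> S D'S; have [dS S0] := rank_class_definable RD' D'S; split=> // D FD.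
have [DD'|] := IH _ FD _ RD'; last by apply.
by case: no; exists D.
Qed.

Definition exact_rank D S : Prop := [/\ rank_class D, D S & ~ split_class D S].

Lemma exact_rank_unique D D' S : exact_rank D S -> exact_rank D' S -> D = D'.
Proof.
move=> [RD DS nDS] [RD' D'S nD'S].
have [/(_ S DS)//|D'D] := rank_class_total RD RD'.
have [/(_ S D'S)//|DD'] := rank_class_total RD' RD.
exact/seteqP.
Qed.

End Rank.

(** * Invariance of the rank *)

Lemma equi_sym (L : language) (M : fo_structure L) (V : Type) (a b : V -> M) :
  equi a b -> equi b a.
Proof. by move=> ab phi; rewrite ab. Qed.

Lemma equi_comp (L : language) (M : fo_structure L) (V W : Type) (g : V -> W)
    (a b : W -> M) :
  equi a b -> equi (a \o g) (b \o g).
Proof. by move=> ab phi; have := ab (ren phi g); rewrite !sat_ren. Qed.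

Lemma equi_suml (L : language) (M : fo_structure L) (V W : Type)
    (a a' : V -> M) (e e' : W -> M) :
  equi (sumf a e) (sumf a' e') -> equi a a'.
Proof. exact: (equi_comp inl). Qed.

Lemma homogeneous_tuple (L : language) (M : fo_structure L) (V : Type) (n : nat)
    (a b : V -> M) (e : 'I_n -> M) :
  homogeneous M -> embeds V nat -> equi a b ->
  exists e' : 'I_n -> M, equi (sumf a e) (sumf b e').
Proof.
move=> hM; elim: n V a b e => [|n IH] V a b e Vnat ab.
  exists e.
  have E (c : V -> M) : sumf c e =
      c \o (fun v : V + 'I_0 => match v with inl v => v | inr i => of_ord0 V i end).
    by apply/funext => -[//|[]].
  by rewrite (E a) (E b); apply: equi_comp.
have [m' am] := hM V a b (e ord0) Vnat ab.
have [e' He'] := IH _ _ _ (e \o lift ord0) (embeds_option Vnat) am.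
exists (fun i => if unlift ord0 i is Some j then e' j else m').
pose g (v : V + 'I_n.+1) : option V + 'I_n :=
  match v with
  | inl v => inl (Some v)
  | inr i => if unlift ord0 i is Some j then inr j else inl None
  end.
have E (c : V -> M) m (f : 'I_n -> M) (f' : 'I_n.+1 -> M) : f' ord0 = m -> f' \o lift ord0 = f ->
    sumf c f' = sumf (fun o => oapp c m o) f \o g.
  by move=> <- <-; apply/funext => -[v|i] //=; case: unliftP => [j ->|->].
rewrite (E a (e ord0) (e \o lift ord0)) // (E b m' e'); first exact: equi_comp.
  by rewrite unlift_none.
by apply/funext => i; rewrite /= liftK.
Qed.

Section RankInvariance.
Variables (L : language) (M : fo_structure L) (d : nat).
Hypothesis hM : homogeneous M.

(** A cut of [dset phi a] with parameters [e] is carried to a cut of [dset phi b]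
   by homogeneity, which extends the correspondence of [a] with [b] to [e]. *)
Lemma rank_class_invariant (D : set (set ('I_d -> M))) (V : Type)
    (phi : formula L ('I_d + V)) (a b : V -> M) :
  rank_class D -> embeds V nat -> equi a b -> D (dset phi a) -> D (dset phi b).
Proof.
move=> RD; elim: RD V phi a b => {D} [D RD IH|F RF IH] V phi a b Vnat ab.
  move=> [Da [_ [[n [psi [e ->]]] D1 D2]]]; split; first exact: IH Da.
  have [e' abe] := homogeneous_tuple e hM Vnat ab.
  have Vn : embeds (V + 'I_n) nat := embeds_sum Vnat (embeds_countType 'I_n).
  exists (dset psi e'); split; first exact: definable_dset.
    by move: D1; rewrite !dsetI; apply: IH.
  by move: D2; rewrite !dsetD; apply: IH.
move=> [_ [x ax] Fa]; split=> [||D FD]; first exact: definable_dset.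
  have [x' abx] := homogeneous_tuple x hM Vnat ab.
  exists x'; move: ax; rewrite /dset /=.
  have E (c : V -> M) (y : 'I_d -> M) : sumf y c = sumf c y \o
      (fun v => match v with inl i => inr i | inr v => inl v end).
    by apply/funext => -[].
  by rewrite (E a x) (E b x'); apply: (equi_comp _ abx phi).1.
by apply: IH (Fa D FD).
Qed.

Lemma exact_rank_invariant (D : set (set ('I_d -> M))) (V : Type)
    (phi : formula L ('I_d + V)) (a b : V -> M) :
  embeds V nat -> equi a b -> exact_rank D (dset phi a) -> exact_rank D (dset phi b).
Proof.
move=> Vnat ab [RD Da nDa]; split=> //; first exact: rank_class_invariant Da.
move=> Db; apply: nDa; apply: rank_class_invariant Db => //; first exact: rank_split.
exact: equi_sym.
Qed.

End RankInvariance.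

(** * Generic filters *)

(** With [p S] read as: almost every tuple lies in [S], the definable members of
   [p] form a complete type over the whole structure. *)
Record generic_filter (L : language) (M : fo_structure L) (d : nat)
    (p : set (set ('I_d -> M))) : Prop := GenericFilter {
  generic_sub : forall A B, A `<=` B -> p A -> p B;
  generic_cap : forall A : nat -> set ('I_d -> M),
    (forall n, p (A n)) -> p (\bigcap_n A n);
  generic_ex : forall A, p A -> A !=set0;
  generic_ultra : forall A, definable A -> p A \/ p (~` A) }.

(** The set defined by [phi] and [c] belongs to [p], as taking it for [P] shows,
   and has the least rank in [p]; the other definable members of [p] are those that
   meet it in this rank. *)
Definition coded (L : language) (M : fo_structure L) (d n : nat)
    (phi : formula L ('I_d + 'I_n)) (c : 'I_n -> M) (p : set (set ('I_d -> M))) : Prop :=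
  exists D, exact_rank D (dset phi c) /\
    forall P, definable P -> p P <-> D (dset phi c `&` P).

Section Generic.
Variables (L : language) (T : set (sentence L)) (M : fo_structure L).
Hypotheses (cL : countable_language L) (st : omega_stable T) (MT : is_model T M).

Lemma genericI (d : nat) (p : set (set ('I_d -> M))) (A B : set ('I_d -> M)) :
  generic_filter p -> p A -> p B -> p (A `&` B).
Proof.
move=> gp pA pB.
have := @generic_cap _ _ _ _ gp (fun n => if n is 0 then A else B).
move=> /(_ _)/generic_sub-/(_ gp); apply; last by case.
by move=> x Hx; split; [apply: (Hx 0)|apply: (Hx 1)].
Qed.

Lemma genericN (d : nat) (p : set (set ('I_d -> M))) (A : set ('I_d -> M)) :
  generic_filter p -> definable A -> p (~` A) <-> ~ p A.
Proof.
move=> gp dA; split=> [pnA pA|npA].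
  by have [x []] := generic_ex gp (genericI gp pA pnA).
by have [] := generic_ultra gp dA.
Qed.

(** Let [D] be the least rank class that contains the definable members of [p]. If
   each of them could be cut inside [D], then [D] would be its own successor, and
   sets could be cut for ever. *)
Lemma generic_coded (d : nat) (p : set (set ('I_d -> M))) :
  generic_filter p ->
  exists (n : nat) (phi : formula L ('I_d + 'I_n)) (c : 'I_n -> M), coded phi c p.
Proof.
move=> gp.
have pT : p [set: 'I_d -> M].
  have [//|pn] := generic_ultra gp (definableT M d).
  exact: generic_sub pn.
pose F (D : set (set ('I_d -> M))) :=
  rank_class D /\ forall P, definable P -> p P -> D P.
pose D := meet_class F.
have RD : rank_class D by apply: rank_meet => D' [].
have pD P : definable P -> p P -> D P.
  by move=> dP pP; split=> // [|D' [_]]; [apply: generic_ex gp _ pP|apply].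
have [S [dS pS nDS]] : exists S, [/\ definable S, p S & ~ split_class D S].
  apply: contrapT => no.
  have FS : F (split_class D).
    split=> [|P dP pP]; first exact: rank_split.
    by apply: contrapT => nP; apply: no; exists P.
  have := @no_splitting_class L T M d D st MT.
  have D0 S : D S -> S !=set0 by case.
  move=> /(_ D0) H; apply: (H _ [set: 'I_d -> M]); last exact: pD (definableT _ _) pT.
  by move=> S [_ _ /(_ _ FS) []].
case: dS pS nDS => n [phi [c ->]] pS nDS; exists n, phi, c, D; split.
  by split=> //; apply: pD => //; apply: definable_dset.
move=> P dP; split=> [pP|DP].
  by apply: pD; [apply: definableI => //; apply: definable_dset|apply: genericI].
have [//|pnP] := generic_ultra gp dP.
case: nDS; split; first by apply: pD => //; apply: definable_dset.
exists P; split=> //; apply: pD.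
  by apply: definableD => //; apply: definable_dset.
by rewrite setDE; apply: genericI.
Qed.

(** Both codes have the same rank [D], by invariance and uniqueness of the exact
   rank; and [D] cannot tell [(c, e)] from [(c', e')]. *)
Lemma coded_uniform (d n : nat) (phi : formula L ('I_d + 'I_n)) (c c' : 'I_n -> M)
    (p p' : set (set ('I_d -> M))) (V : Type) (psi : formula L ('I_d + V)) (e e' : V -> M) :
  homogeneous M -> coded phi c p -> coded phi c' p' ->
  embeds V nat -> equi (sumf c e) (sumf c' e') ->
  p (dset psi e) -> p' (dset psi e').
Proof.
move=> hM [D [eD pD]] [D' [eD' pD']] Vnat ce.
have cc' := equi_suml ce.
have nV := embeds_countType 'I_n.
have DD' := exact_rank_unique (exact_rank_invariant hM nV cc' eD) eD'.
rewrite pD ?pD' -?DD'; try exact: definable_dset.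
rewrite !dsetI; apply: rank_class_invariant => //; first by case: eD.
exact: embeds_sum.
Qed.

End Generic.

Record sigma_ideal (I : Type) (J : set (set I)) : Prop := SigmaIdeal {
  ideal0 : J set0;
  ideal_sub : forall A B, A `<=` B -> J B -> J A;
  ideal_cup : forall A : nat -> set I, (forall n, J (A n)) -> J (\bigcup_n A n);
  ideal_proper : ~ J [set: I] }.

(** Otherwise the definable sets whose preimage is not in [J] could be cut for
   ever. *)
Lemma generic_of_ideal (L : language) (T : set (sentence L)) (M : fo_structure L)
    (d : nat) (I : Type) (J : set (set I)) (x : I -> ('I_d -> M)) :
  omega_stable T -> is_model T M -> sigma_ideal J ->
  exists S, ~ J (x @^-1` S) /\
    generic_filter [set Z | J (x @^-1` (S `\` Z))].
Proof.
move=> st MT sJ; have J0 := ideal0 sJ.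
have JU A B : J A -> J B -> J (A `|` B).
  move=> JA JB; have := @ideal_cup _ _ sJ (fun n => if n is 0 then A else B).
  move=> /(_ _)/(ideal_sub sJ); apply; last by case.
  by move=> i [Ai|Bi]; [exists 0|exists 1].
pose D (S : set ('I_d -> M)) := definable S /\ ~ J (x @^-1` S).
have [S [dS nJS] nsplit] : exists2 S, D S & forall P, definable P ->
    J (x @^-1` (S `&` P)) \/ J (x @^-1` (S `\` P)).
  apply: contrapT => no.
  have := @no_splitting_class L T M d D st MT.
  have D0 S : D S -> S !=set0.
    move=> [_ nJ]; apply: contrapT => S0; apply: nJ; apply: ideal_sub J0 => // i Si.
    by apply: S0; exists (x i).
  move=> /(_ D0) H; apply: (H _ [set: 'I_d -> M]).
    move=> S DS; apply: contrapT => nP; apply: no; exists S => // P dP.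
    have [J1|J1] := EM (J (x @^-1` (S `&` P))); first by left.
    right; apply: contrapT => J2; apply: nP; exists P; split=> //.
      by split=> //; apply: definableI => //; case: DS.
    by split=> //; apply: definableD => //; case: DS.
  by split; [apply: definableT|rewrite preimage_setT; apply: ideal_proper].
exists S; split=> //; split=> /= [A B AB|A JA|A JA|A dA].
- by apply: ideal_sub => // i [Si nB]; split=> // /AB.
- have := ideal_cup sJ JA; apply: ideal_sub => // i [Si nA].
  have [n nAn] : exists n, ~ A n (x i).
    by apply: contrapT => no; apply: nA => n _; apply: contrapT => nn; apply: no; exists n.
  by exists n.
- apply: contrapT => A0; apply: nJS; apply: ideal_sub JA => // i Si; split=> // Ai.
  by apply: A0; exists (x i).
- have [J1|J1] := nsplit _ dA; [right|by left].
  by rewrite setDE setCK.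
Qed.

(** * Typical tuples *)

(** The condition [P t] sees only the values below [t], so a partial function can be
   completed by a default value before the next choice. *)
Lemma wf_choice (Th A : Type) (lt : Th -> Th -> Prop) (P : Th -> (Th -> A) -> A -> Prop) :
  well_founded lt -> inhabited A ->
  (forall t f g a, (forall s, lt s t -> f s = g s) -> P t f a -> P t g a) ->
  (forall t f, exists a, P t f a) ->
  exists f, forall t, P t f (f t).
Proof.
move=> wf [a0] Pext Pex.
have /choice[g Hg] : forall tf : Th * (Th -> A), exists a, P tf.1 tf.2 a.
  by move=> [t f]; apply: Pex.
pose ext t (h : forall s, lt s t -> A) s :=
  if pselect (lt s t) is left H then h s H else a0.
pose F := Fix wf (fun=> A) (fun t h => g (t, ext t h)).
have FE t : F t = g (t, fun s => if pselect (lt s t) then F s else a0).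
  rewrite /F Fix_eq //; first by congr (g (_, _)); apply/funext => s; rewrite /ext; case: pselect.
  move=> s h h' E; congr (g (_, ext _ _)).
  by apply: functional_extensionality_dep => z; apply/funext => H.
exists F => t; have := Hg (t, fun s => if pselect (lt s t) then F s else a0).
rewrite -FE /=; apply: Pext => s st.
by case: pselect.
Qed.

(** [p'] contains what [p] becomes when [c] is replaced by [c']; for [c = c'] and
   [p = p'], the type [p] is invariant over [c]. *)
Definition uniform_rule (L : language) (M : fo_structure L) (d n : nat)
    (c c' : 'I_n -> M) (p p' : set (set ('I_d -> M))) : Prop :=
  forall (V : Type) (psi : formula L ('I_d + V)) (e e' : V -> M), embeds V nat ->
    equi (sumf c e) (sumf c' e') -> p (dset psi e) -> p' (dset psi e').

Definition typical (L : language) (M : fo_structure L) (d : nat)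
    (p : set (set ('I_d -> M))) (B : set M) (x : 'I_d -> M) : Prop :=
  forall (n : nat) (psi : formula L ('I_d + 'I_n)) (e : 'I_n -> M),
    (forall i, B (e i)) -> p (dset psi e) -> dset psi e x.

Lemma typical_dset (L : language) (M : fo_structure L) (d : nat)
    (p : set (set ('I_d -> M))) (B : set M) (x : 'I_d -> M) (V : Type)
    (psi : formula L ('I_d + V)) (e : V -> M) :
  typical p B x -> (forall v, B (e v)) -> p (dset psi e) -> dset psi e x.
Proof.
move=> tx Be; have [n [g [phi ->]]] := finite_params psi.
by rewrite dset_ren; exact: tx _ _ _ (fun i => Be (g i)).
Qed.

Lemma typical_sub (L : language) (M : fo_structure L) (d : nat)
    (p : set (set ('I_d -> M))) (B C : set M) (x : 'I_d -> M) :
  C `<=` B -> typical p B x -> typical p C x.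
Proof. by move=> CB tx n psi e Ce; exact: tx _ _ _ (fun i => CB _ (Ce i)). Qed.

Lemma typical_iff (L : language) (M : fo_structure L) (d : nat)
    (p : set (set ('I_d -> M))) (B : set M) (x : 'I_d -> M) (V : Type)
    (psi : formula L ('I_d + V)) (e : V -> M) :
  generic_filter p -> typical p B x -> (forall v, B (e v)) ->
  p (dset psi e) <-> dset psi e x.
Proof.
move=> gp tx Be; split; first exact: typical_dset tx Be.
move=> ex; have [//|np] := generic_ultra gp (definable_dset psi e).
by case: (typical_dset (psi := Not psi) tx Be np).
Qed.

(** Over [B], a filter has only one type of typical tuples. *)
Lemma typical_equi (L : language) (M : fo_structure L) (d : nat)
    (p : set (set ('I_d -> M))) (B : set M) (x y : 'I_d -> M) (V : Type) (e : V -> M) :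
  generic_filter p -> typical p B x -> typical p B y -> (forall v, B (e v)) ->
  equi (sumf x e) (sumf y e).
Proof.
move=> gp tx ty Be phi.
have := typical_iff phi gp tx Be; have := typical_iff phi gp ty Be.
by rewrite /dset /= => <- <-.
Qed.

(** * Commuting generic quantifiers *)

Section Fubini.
Variables (L : language) (T : set (sentence L)) (M : fo_structure L).
Hypotheses (cL : countable_language L) (st : omega_stable T) (MT : is_model T M).

(** There are only countably many formulas over a countable family. *)
Lemma typical_generic (d : nat) (p : set (set ('I_d -> M))) (V : Type) (e : V -> M) :
  generic_filter p -> embeds V nat -> p [set x | typical p (range e) x].
Proof.
move=> gp Vnat.
have [code codeI] := formula_countable cL (embeds_sum (embeds_countType 'I_d) Vnat).
pose A n := [set x | forall psi : formula L ('I_d + V), code psi = n ->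
  p (dset psi e) -> dset psi e x].
have pA n : p (A n).
  have [[psi [psin ppsi]]|no] := EM (exists psi, code psi = n /\ p (dset psi e)).
    by apply: generic_sub ppsi => // x Hx psi' E _; have -> : psi' = psi by apply: codeI; rewrite E.
  have pT : p [set: 'I_d -> M].
    have [//|pn] := generic_ultra gp (definableT M d).
    by apply: generic_sub pn.
  apply: generic_sub pT => // x _ psi E ppsi.
  by case: no; exists psi.
have := generic_cap gp pA; apply: generic_sub => // x Ax n psi b rb.
have /choice[g Hg] i : exists v, e v = b i by have [v _ <-] := rb i; exists v.
have -> : b = e \o g by apply/funext => i /=; rewrite Hg.
by rewrite -dset_ren; apply: (Ax (code (ren psi (sum_shift g)))).
Qed.

Definition swap_sum (A B C : Type) (v : (A + B) + C) : B + (A + C) :=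
  match v with
  | inl (inl a) => inr (inl a)
  | inl (inr b) => inl b
  | inr c => inr (inr c)
  end.

Definition assoc_sum (A B C : Type) (v : (A + B) + C) : A + (B + C) :=
  match v with
  | inl (inl a) => inl a
  | inl (inr b) => inr (inl b)
  | inr c => inr (inr c)
  end.

Lemma sumf_swap (A B C : Type) (x : A -> M) (y : B -> M) (e : C -> M) :
  sumf (sumf x y) e = sumf y (sumf x e) \o @swap_sum A B C.
Proof. by apply/funext => -[[]|]. Qed.

Lemma sumf_assoc (A B C : Type) (x : A -> M) (y : B -> M) (e : C -> M) :
  sumf (sumf x y) e = sumf x (sumf y e) \o @assoc_sum A B C.
Proof. by apply/funext => -[[]|]. Qed.

Lemma section_invariant (d n : nat) (q : set (set ('I_d -> M))) (c : 'I_n -> M)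
    (V : Type) (psi : formula L ('I_d + ('I_d + V))) (e : V -> M) (x x' : 'I_d -> M) :
  uniform_rule c c q q -> embeds V nat ->
  equi (sumf x (sumf c e)) (sumf x' (sumf c e)) ->
  q (dset psi (sumf x e)) -> q (dset psi (sumf x' e)).
Proof.
move=> uq Vnat xx'; apply: uq; first exact: embeds_sum (embeds_countType _) Vnat.
pose g (v : 'I_n + ('I_d + V)) : 'I_d + ('I_n + V) :=
  match v with inl i => inr (inl i) | inr (inl i) => inl i | inr (inr v) => inr (inr v) end.
have E y : sumf c (sumf y e) = sumf y (sumf c e) \o g by apply/funext => -[|[]].
by rewrite (E x) (E x'); apply: equi_comp.
Qed.

(** Generic quantifiers commute: otherwise tuples chosen generic alternately for
   [p] and for [q] would be ordered by [psi]. *)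
Lemma generic_commute (d n m : nat) (p q : set (set ('I_d -> M)))
    (c : 'I_n -> M)
    (psi : formula L (('I_d + 'I_d) + 'I_m)) (e : 'I_m -> M) :
  generic_filter p -> generic_filter q -> uniform_rule c c p p ->
  p [set x | q [set y | sat psi (sumf (sumf x y) e)]] ->
  q [set y | p [set x | sat psi (sumf (sumf x y) e)]].
Proof.
move=> gp gq up pQ; set Q := [set x | _] in pQ; set R := [set y | _].
have sectx x : [set y | sat psi (sumf (sumf x y) e)] =
    dset (ren psi (@swap_sum _ _ _)) (sumf x e).
  by apply/funext => y; apply/propext; rewrite /dset /= sat_ren -sumf_swap.
have secty y : [set x | sat psi (sumf (sumf x y) e)] =
    dset (ren psi (@assoc_sum _ _ _)) (sumf y e).
  by apply/funext => x; apply/propext; rewrite /dset /= sat_ren -sumf_assoc.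
apply: contrapT => nqR.
have qtyp := typical_generic (sumf c e) gq (embeds_sum (embeds_countType _) (embeds_countType _)).
have qnR : q (~` R).
  have [[y0 [ty0 Ry0]]|no] := EM (exists y0, typical q (range (sumf c e)) y0 /\ R y0); last first.
    by apply: generic_sub qtyp => // y ty Ry; apply: no; exists y.
  (* R is invariant over (c, e), so it contains all typical tuples or none. *)
  case: nqR; apply: generic_sub qtyp => // y ty.
  move: Ry0; rewrite /R /= !secty; apply: section_invariant up _ _.
    exact: embeds_countType.
  by apply: typical_equi gq ty0 ty _ => v; exists v.
pose good (w : ('I_d -> M) * ('I_d -> M)) := Q w.1 /\ ~ R w.2.
pose ext k (f : nat -> ('I_d -> M) * ('I_d -> M)) w :=
  (forall i, i < k -> good (f i)) ->
  [/\ good w, forall i, i < k -> ~ sat psi (sumf (sumf w.1 (f i).2) e),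
      forall i, i < k -> sat psi (sumf (sumf (f i).1 w.2) e) &
      sat psi (sumf (sumf w.1 w.2) e)].
have [m0] := carrier_inhabited M.
have pfin (r : set (set ('I_d -> M))) k (S : nat -> set ('I_d -> M)) (S0 : set ('I_d -> M)) :
    generic_filter r -> r S0 -> (forall i, i < k -> r (S i)) ->
    exists2 x, S0 x & forall i, i < k -> S i x.
  move=> gr rS0 rS.
  have : r (\bigcap_i (if i < k then S i else S0)).
    by apply: generic_cap gr _ _ => i; case: ifP => // /rS.
  move=> rI; have [x [S0x Sx]] := generic_ex gr (genericI gr rS0 rI).
  by exists x => // i ik; have := Sx i Logic.I; rewrite ik.
have [||||f Hf] := @wf_choice _ _ (fun i j : nat => i < j) ext.
- by elim/ltn_ind=> i IH; constructor => j; apply: IH.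
- by split; split=> _.
- move=> k f g w fg H G; have [|? H1 H2 ?] := H; first by move=> i ik; rewrite fg //; apply: G.
  by split=> // i ik; rewrite -fg //; [apply: H1|apply: H2].
- move=> k f; have [G|nG] := EM (forall i, i < k -> good (f i)); last by exists (f 0).
  have [u Qu Hu] : exists2 u, Q u & forall i, i < k -> ~ sat psi (sumf (sumf u (f i).2) e).
    apply: (pfin p k (fun i => [set x | ~ sat psi (sumf (sumf x (f i).2) e)])) => // i ik.
    have [_] := G i ik; rewrite /R /= secty -(genericN gp); last exact: definable_dset.
    by rewrite -secty.
  have [v [nRv Huv] Hv] : exists2 v, (~` R `&` [set y | sat psi (sumf (sumf u y) e)]) v &
      forall i, i < k -> sat psi (sumf (sumf (f i).1 v) e).
    apply: (pfin q k (fun i => [set y | sat psi (sumf (sumf (f i).1 y) e)])) => //.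
      exact: genericI.
    by move=> i ik; have [] := G i ik.
  by exists (u, v).
have G k : good (f k).
  have : forall i, i <= k -> good (f i); last by apply.
  elim: k => [|k IH] i; first by rewrite leqn0 => /eqP ->; case: (Hf 0).
  by rewrite leq_eqVlt => /predU1P[->|/IH//]; case: (Hf k.+1) => // j /IH.
apply: (@no_order_property L T M d m psi e (fun k => (f k).1) (fun k => (f k).2) st MT).
move=> k l; have [_ Hk _ _] := Hf k (fun i _ => G i).
have [_ _ Hl Hll] := Hf l (fun i _ => G i).
by split=> [|]; [apply: contraPT; rewrite -ltnNge => /Hk|rewrite leq_eqVlt => /predU1P[->|/Hl]].
Qed.

End Fubini.

(** * Families of mutually typical tuples *)

Section GenericFamilies.
Variables (L : language) (T : set (sentence L)) (M : fo_structure L).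
Hypotheses (cL : countable_language L) (st : omega_stable T) (MT : is_model T M).

(** Symmetry of independence. Suppose that [psi] holds at [z] for almost all [x]
   but not for [y]. As [z] is typical over [y], almost all [w] fail [psi] with
   [y]; as [y] is typical, almost all [w] fail [psi] with almost all [x]. After
   commuting the quantifiers, a typical [w] fails [psi] with almost all [x], and
   so does [z], which has the same type: a contradiction. *)
Lemma typical_swap (d n n' : nat) (p q : set (set ('I_d -> M)))
    (c : 'I_n -> M) (c' : 'I_n' -> M) (B : set M) (y z : 'I_d -> M) :
  generic_filter p -> generic_filter q ->
  uniform_rule c c p p -> uniform_rule c' c' q q ->
  range c `<=` B -> range c' `<=` B ->
  typical p B y -> typical q (B `|` range y) z -> typical p (B `|` range z) y.
Proof.
move=> gp gq up uq cB c'B ty tz m psi e Be.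
have /choice[g Hg] k : exists v : set_type B + 'I_d, sumf (fun b : set_type B => \val b) z v = e k.
  have [b|[i _ <-]] := Be k; first by exists (inl (SigSub (mem_set b))).
  by exists (inr i).
pose h (v : 'I_d + 'I_m) : ('I_d + 'I_d) + set_type B :=
  match v with
  | inl i => inl (inl i)
  | inr k => match g k with inl b => inr b | inr i => inl (inr i) end
  end.
have [k [r [phi phiE]]] := finite_params (ren psi h).
pose b i : M := \val (r i).
have Bb i : B (b i) by apply: set_valP.
have psiE : dset psi e = [set x | sat phi (sumf (sumf x z) b)].
  apply/funext => x; apply/propext; rewrite /dset /=.
  have -> : sumf x e = sumf (sumf x z) (fun b : set_type B => \val b) \o h.
    apply/funext => -[i|i] //=; rewrite -Hg /h.
    by case: (g i).
  rewrite -sat_ren phiE sat_ren.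
  by have -> : sumf (sumf x z) (fun b : set_type B => \val b) \o sum_shift r = sumf (sumf x z) b
    by apply/funext => -[].
rewrite psiE => pz; apply: contrapT => nyz.
have sectx x : [set y | ~ sat phi (sumf (sumf x y) b)] =
    dset (ren (Not phi) (@swap_sum _ _ _)) (sumf x b).
  by apply/funext => w; apply/propext; rewrite /dset /= sat_ren -sumf_swap.
have secty w : [set x | ~ sat phi (sumf (sumf x w) b)] =
    dset (ren (Not phi) (@assoc_sum _ _ _)) (sumf w b).
  by apply/funext => x; apply/propext; rewrite /dset /= sat_ren -sumf_assoc.
have cbB v : B (sumf c b v) by case: v => [i|i] /=; [apply: cB; exists i|].
have c'bB v : B (sumf c' b v) by case: v => [i|i] /=; [apply: c'B; exists i|].
have qy : q [set w | ~ sat phi (sumf (sumf y w) b)].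
  rewrite sectx; apply/(typical_iff _ gq tz).
    by case=> [i|i] /=; [right; exists i|left].
  by rewrite -sectx.
have pq : p [set x | q [set w | ~ sat phi (sumf (sumf x w) b)]].
  have ptyp := typical_generic cL (sumf c' b) gp
    (embeds_sum (embeds_countType _) (embeds_countType _)).
  apply: (generic_sub gp _ ptyp) => x tx.
  rewrite /= sectx; move: qy; rewrite sectx; apply: (section_invariant uq).
    exact: embeds_countType.
  have ty' : typical p (range (sumf c' b)) y.
    by apply: typical_sub ty => _ [v _ <-].
  by apply: typical_equi gp ty' tx _ => v; exists v.
have qp := generic_commute (psi := Not phi) cL st MT gp gq up pq.
have qtyp := typical_generic cL (sumf c b) gq
  (embeds_sum (embeds_countType _) (embeds_countType _)).
have [w [tw /=]] := generic_ex gq (genericI gq qtyp qp).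
rewrite [X in p X]secty => pw.
have pnz : p [set x | ~ sat phi (sumf (sumf x z) b)].
  rewrite secty; apply: (section_invariant up) pw; first exact: embeds_countType.
  have tz' : typical q (range (sumf c b)) z.
    by apply: typical_sub tz => _ [v _ <-]; left.
  by apply: typical_equi gq tw tz' _ => v; exists v.
by have [x []] := generic_ex gp (genericI gp pz pnz).
Qed.

Variables (Th : Type) (lt : Th -> Th -> Prop).
Hypotheses (lt_wf : well_founded lt)
  (lt_trans : forall s t u, lt s t -> lt t u -> lt s u)
  (lt_total : forall s t, [\/ lt s t, s = t | lt t s]).

Definition coords (d : nat) (y : Th -> ('I_d -> M)) (P : set Th) : set M :=
  [set m | exists2 s, P s & range (y s) m].

(** Formulas having finitely many parameters, an induction on a bound for the indices
   of these passes through limit indices. *)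
Lemma finite_max (d m : nat) (y : Th -> ('I_d -> M)) (B : set M) (P : set Th) (e : 'I_m -> M) :
  (forall i, (B `|` coords y P) (e i)) ->
  (forall i, B (e i)) \/
  exists2 s, P s & forall i, (B `|` coords y [set u | P u /\ (lt u s \/ u = s)]) (e i).
Proof.
elim: m e => [|m IH] e He; first by left => -[].
have [Be|[s Ps Hs]] := IH (e \o lift ord0) (fun i => He _).
  have [B0|[s Ps ys]] := He ord0.
    by left => i; have [j ->|->] := unliftP ord0 i; [apply: Be|].
  right; exists s => // i; have [j ->|->] := unliftP ord0 i; first by left; apply: Be.
  by right; exists s => //; split=> //; right.
right; have [B0|[u Pu yu]] := He ord0.
  exists s => // i; have [j ->|->] := unliftP ord0 i; last by left.
  exact: Hs.
have [us|su] : (lt u s \/ u = s) \/ lt s u.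
  by have [?|?|?] := lt_total u s; tauto.
  exists s => // i; have [j ->|->] := unliftP ord0 i; first exact: Hs.
  by right; exists u.
exists u => // i; have [j ->|->] := unliftP ord0 i; last first.
  by right; exists u => //; split=> //; right.
have [B1|[v [Pv vs] yv]] := Hs j; first by left.
right; exists v => //; split=> //; left.
by case: vs => [vs|-> //]; apply: lt_trans su.
Qed.

(** By induction on [s], the tuple at [t] is typical over those of index at most
   [s]. If [t] is below [s], it is typical over those below [s] by induction, and
   [typical_swap] adds the tuple at [s], which is typical over all of these and
   over the tuple at [t]. *)
Lemma typical_unordered (d n : nat) (p : Th -> set (set ('I_d -> M)))
    (c : Th -> 'I_n -> M) (y : Th -> 'I_d -> M) (B : set M) :
  (forall t, generic_filter (p t)) -> (forall t, uniform_rule (c t) (c t) (p t) (p t)) ->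
  (forall t, range (c t) `<=` B) ->
  (forall t, typical (p t) (B `|` coords y [set s | lt s t]) (y t)) ->
  forall t, typical (p t) (B `|` coords y [set s | s <> t]) (y t).
Proof.
move=> gp up cB ty.
have claim s : forall t, s <> t ->
    typical (p t) (B `|` coords y [set u | u <> t /\ (lt u s \/ u = s)]) (y t).
  elim/(well_founded_ind lt_wf): s => s IH t st'.
  have lt_irr u : ~ lt u u by elim/(well_founded_ind lt_wf): u => u IHu uu; exact: (IHu u uu uu).
  have [ts|//|ts] := lt_total s t.
    apply: typical_sub (ty t) => m [Bm|[u [ut us] yu]]; first by left.
    right; exists u => //=; case: us => [us|-> //]; exact: lt_trans ts.
  have ty1 : typical (p t) (B `|` coords y [set u | u <> t /\ lt u s]) (y t).
    move=> k psi e He.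
    have [Be|[u [ut us] He']] := finite_max He.
      by apply: (ty t) => i; left.
    apply: (IH u us t ut) => i; have [Bi|[v [[vt vs] vu] yv]] := He' i; first by left.
    by right; exists v.
  have tz : typical (p s) ((B `|` coords y [set u | u <> t /\ lt u s]) `|` range (y t)) (y s).
    apply: typical_sub (ty s) => m [[Bm|[u [ut us] yu]]|yt]; first by left.
      by right; exists u.
    by right; exists t.
  have := typical_swap (gp t) (gp s) (up t) (up s) _ _ ty1 tz.
  have cB' u : range (c u) `<=` B `|` coords y [set u | u <> t /\ lt u s].
    by move=> m /cB; left.
  move=> /(_ (cB' t) (cB' s)); apply: typical_sub => m [Bm|[u [ut us] yu]].
    by left; left.
  case: us yu => [us|->] yu; last by right.
  by left; right; exists u.
move=> t k psi e He.
have [Be|[s st' He']] := finite_max He; first by apply: (ty t) => i; left.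
exact: claim st' _ _ _ He'.
Qed.

End GenericFamilies.

(** The tuples are added one by one. A new one satisfies exactly the formulas of
   its filter over the previous ones, and by hypothesis these are determined by
   the type of the parameters [c] and of the previous tuples. Indices may be
   repeated, provided that both families have the same repetitions. *)
Lemma typical_family_equi (L : language) (M : fo_structure L) (Th : Type) (d n : nat)
    (p : Th -> set (set ('I_d -> M))) (c : Th -> 'I_n -> M) (y : Th -> 'I_d -> M)
    (B : set M) (W : Type) (e e' : W -> M) (k : nat) (t t' : 'I_k -> Th)
    (g : 'I_k -> 'I_n -> W) :
  (forall t, generic_filter (p t)) ->
  (forall t t', uniform_rule (c t) (c t') (p t) (p t')) ->
  (forall t, typical (p t) (B `|` coords y [set s | s <> t]) (y t)) ->
  embeds W nat -> (forall w, B (e w)) -> (forall w, B (e' w)) ->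
  (forall i, e \o g i = c (t i)) -> (forall i, e' \o g i = c (t' i)) ->
  (forall i j, t i = t j <-> t' i = t' j) -> equi e e' ->
  equi (sumf e (fun ij : 'I_k * 'I_d => y (t ij.1) ij.2))
       (sumf e' (fun ij : 'I_k * 'I_d => y (t' ij.1) ij.2)).
Proof.
move=> gp up ty Wnat Be Be'.
elim: k t t' g => [|k IH] t t' g gt gt' tt' ee'.
  have E f (u : 'I_0 * 'I_d -> M) : sumf f u = f \o
      (fun v : W + 'I_0 * 'I_d => match v with inl w => w | inr ij => of_ord0 W ij.1 end).
    by apply/funext => -[//|[[]]].
  by rewrite (E e) (E e'); apply: equi_comp.
pose yr (t : 'I_k.+1 -> Th) (ij : 'I_k * 'I_d) := y (t (lift ord0 ij.1)) ij.2.
have rest : equi (sumf e (yr t)) (sumf e' (yr t')).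
  apply: (IH (t \o lift ord0) (t' \o lift ord0) (g \o lift ord0)) => //.
    by move=> i; apply: gt.
    by move=> i; apply: gt'.
  by move=> i j; apply: tt'.
have [[j0 tj0]|fresh] := EM (exists j, t ord0 = t (lift ord0 j)).
  pose h (v : W + 'I_k.+1 * 'I_d) : W + 'I_k * 'I_d :=
    match v with
    | inl w => inl w
    | inr (i, j) => inr (odflt j0 (unlift ord0 i), j)
    end.
  have E f (u : 'I_k.+1 -> Th) : u ord0 = u (lift ord0 j0) ->
      sumf f (fun ij : 'I_k.+1 * 'I_d => y (u ij.1) ij.2) = sumf f (yr u) \o h.
    move=> uE; apply/funext => -[w|[i j]] //=.
    by case: unliftP => [i' ->|->] //=; rewrite uE.
  by rewrite (E e) // (E e'); [apply: equi_comp|apply/tt'].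
have inB (f : W -> M) (u : 'I_k.+1 -> Th) v :
    (forall j, u (lift ord0 j) <> u ord0) -> (forall w, B (f w)) ->
    (B `|` coords y [set s | s <> u ord0]) (sumf f (yr u) v).
  move=> uI Bf; case: v => [w|[i j]] /=; first by left.
  by right; exists (u (lift ord0 i)); [exact: uI|exists j].
have tI j : t (lift ord0 j) <> t ord0 by move=> E; apply: fresh; exists j.
have t'I j : t' (lift ord0 j) <> t' ord0 by move=> /tt'/tI.
have WV : embeds (W + 'I_k * 'I_d) nat by apply: embeds_sum => //; apply: embeds_countType.
have add : equi (sumf (y (t ord0)) (sumf e (yr t))) (sumf (y (t' ord0)) (sumf e' (yr t'))).
  move=> phi.
  have := typical_iff phi (gp (t ord0)) (ty (t ord0)) (fun v => inB e t v tI Be).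
  have := typical_iff phi (gp (t' ord0)) (ty (t' ord0)) (fun v => inB e' t' v t'I Be').
  rewrite /dset /= => <- <-.
  pose h (i : 'I_n + (W + 'I_k * 'I_d)) : W + 'I_k * 'I_d :=
    match i with inl i => inl (g ord0 i) | inr v => v end.
  have E : equi (sumf (c (t ord0)) (sumf e (yr t))) (sumf (c (t' ord0)) (sumf e' (yr t'))).
    have -> : sumf (c (t ord0)) (sumf e (yr t)) = sumf e (yr t) \o h.
      by apply/funext => -[i|v] //=; rewrite -gt.
    have -> : sumf (c (t' ord0)) (sumf e' (yr t')) = sumf e' (yr t') \o h.
      by apply/funext => -[i|v] //=; rewrite -gt'.
    exact: equi_comp.
  by split; apply: up => //; apply: equi_sym.
pose h (v : W + 'I_k.+1 * 'I_d) : 'I_d + (W + 'I_k * 'I_d) :=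
  match v with
  | inl w => inr (inl w)
  | inr (i, j) => if unlift ord0 i is Some i' then inr (inr (i', j)) else inl j
  end.
have E f (u : 'I_k.+1 -> Th) : sumf f (fun ij : 'I_k.+1 * 'I_d => y (u ij.1) ij.2) =
    sumf (y (u ord0)) (sumf f (yr u)) \o h.
  by apply/funext => -[w|[i j]] //=; case: unliftP => [i' ->|->].
by rewrite (E e) (E e'); apply: equi_comp.
Qed.

(** * Cardinal arithmetic *)

Lemma embeds_prod (T T' U U' : Type) : embeds T T' -> embeds U U' -> embeds (T * U) (T' * U').
Proof.
move=> [f fI] [g gI]; exists (fun p => (f p.1, g p.2)).
by move=> [x y] [x' y'] [/fI-> /gI->].
Qed.

Lemma embeds_sum_map (T T' U U' : Type) :
  embeds T T' -> embeds U U' -> embeds (T + U) (T' + U').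
Proof.
move=> [f fI] [g gI].
exists (fun p => match p with inl x => inl (f x) | inr y => inr (g y) end).
by move=> [x|y] [x'|y'] // [] => [/fI->|/gI->].
Qed.

Lemma card_le_embeds (T U : Type) (A : set T) (B : set U) :
  A #<= B <-> embeds (set_type A) (set_type B).
Proof.
split=> [/card_leP[f]|[f fI]].
  by exists f => x y /inj; apply; rewrite inE.
by apply/card_leP; apply/injfunPex; exists f => // x y _ _; apply: fI.
Qed.

Lemma set_type_setT (T : Type) : embeds T (set_type [set: T]).
Proof. by exists (fun t => SigSub (mem_set (Logic.I : [set: T] t))) => x y []. Qed.

Lemma embeds_val (T : Type) (A : set T) : embeds (set_type A) T.
Proof. by exists val; apply: val_inj. Qed.

Lemma card_leT_embeds (T U : Type) : [set: T] #<= [set: U] <-> embeds T U.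
Proof.
rewrite card_le_embeds; split=> h.
  exact: embeds_trans (set_type_setT T) (embeds_trans h (embeds_val _)).
exact: embeds_trans (embeds_val _) (embeds_trans h (set_type_setT U)).
Qed.

(** A maximal partial injection is total or surjective. *)
Lemma embeds_total (T U : Type) : embeds T U \/ embeds U T.
Proof.
pose P (G : set (T * U)) := (forall x y y', G (x, y) -> G (x, y') -> y = y') /\
  (forall x x' y, G (x, y) -> G (x', y) -> x = x').
have [|G [[Gf Gi] Gmax]] := @Zorn_bigcup _ P.
  move=> F FP Ftot.
  have two p q : (\bigcup_(X in F) X) p -> (\bigcup_(X in F) X) q ->
      exists X, [/\ F X, X p & X q].
    move=> [X FX Xp] [Y FY Yq]; have [XY|YX] := Ftot X Y FX FY.
      by exists Y; split=> //; apply: XY.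
    by exists X; split=> //; apply: YX.
  split=> x y y' H H'; have [X [/FP[Xf Xi] X1 X2]] := two _ _ H H'.
    exact: Xf X1 X2.
  exact: Xi X1 X2.
have [domT|/existsNP[x nx]] := EM (forall x, exists y, G (x, y)).
  left; have /choice[f Hf] := domT; exists f => x x' E.
  by apply: Gi (Hf x) _; rewrite E.
have [ranT|/existsNP[y ny]] := EM (forall y, exists x, G (x, y)).
  right; have /choice[f Hf] := ranT; exists f => y y' E.
  by apply: Gf (Hf y) _; rewrite E.
exfalso; apply: (Gmax (G `|` [set (x, y)])).
  split; first by move=> p; left.
  by move=> /(_ (x, y))H; apply: nx; exists y; apply: H; right.
split.
  move=> a b b' [H|[-> ->]] [H'|[]].
  - exact: Gf H H'.
  - by move=> aE _; case: nx; exists b; rewrite -aE.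
  - by case: nx; exists b'.
  - by move=> ->.
move=> a a' b [H|[-> ->]] [H'|[]].
- exact: Gi H H'.
- by move=> _ bE; case: ny; exists a; rewrite -bE.
- by case: ny; exists a'.
- by move=> ->.
Qed.

Lemma embeds_double (W : Type) : embeds nat W -> embeds (W * W) W -> embeds (W + W) W.
Proof.
move=> [i iI] WW; apply: embeds_trans WW.
exists (fun w => match w with inl w => (i 0, w) | inr w => (i 1, w) end).
by move=> [x|x] [y|y] [] // => [->|/iI|/iI|->].
Qed.

(** Hessenberg's theorem, by Zorn's lemma: among the graphs of injections of
   [A * A] into [A], for subsets [A] of [W] containing the image of [i], a maximal
   one has a field [A] as large as [W]. Otherwise a copy of [A] fits in the
   complement of [A], and it has enough room for the images of the new pairs. *)
Section Square.
Variables (W : Type) (i : nat -> W).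
Hypothesis iI : injective i.

Let fld (G : set ((W * W) * W)) : set W := [set a | exists w, G ((a, a), w)].

Let wf (G : set ((W * W) * W)) : Prop :=
  [/\ forall p w w', G (p, w) -> G (p, w') -> w = w',
      forall p p' w, G (p, w) -> G (p', w) -> p = p',
      forall a b w, G ((a, b), w) -> [/\ fld G a, fld G b & fld G w] &
      forall a b, fld G a -> fld G b -> exists w, G ((a, b), w)].

Let G0 : set ((W * W) * W) :=
  [set q | exists m n : nat, q = ((i m, i n), i (pickle (m, n)))].

Let wf0 : wf G0.
Proof.
have f0 m : fld G0 (i m) by exists (i (pickle (m, m))), m, m.
split.
- by move=> p w w' [m [n [-> ->]]] [m' [n' [/iI-> /iI-> ->]]].
- move=> p p' w [m [n [-> ->]]] [m' [n' [-> /iI]]].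
  by move=> /(pcan_inj pickleK)[-> ->].
- by move=> a b w [m [n [-> -> ->]]].
- move=> a b [w [m [n [-> _ _]]]] [w' [m' [n' [-> _ _]]]].
  by exists (i (pickle (m, m'))), m, m'.
Qed.

Let square_extend (G : set ((W * W) * W)) : wf G -> G0 `<=` G ->
  embeds (fld G) (~` fld G) -> exists G', G `<` G' /\ wf G'.
Proof.
move=> [Gf Gi Gs Gt] G0G [g0 g0I].
pose A := fld G.
have iA n : A (i n) by exists (i (pickle (n, n))); apply: G0G; exists n, n.
have /choice[g Hg] a : exists b, forall Aa : A a, b = \val (g0 (SigSub (mem_set Aa))).
  have [Aa|nAa] := EM (A a); last by exists a => Aa; case: (nAa Aa).
  by exists (\val (g0 (SigSub (mem_set Aa)))) => Aa'; rewrite (Prop_irrelevance Aa' Aa).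
have gA a : A a -> ~ A (g a) by move=> Aa; rewrite (Hg a Aa); exact: (set_valP (g0 _)).
have gI a b : A a -> A b -> g a = g b -> a = b.
  by move=> Aa Ab; rewrite (Hg a Aa) (Hg b Ab) => /val_inj/g0I[].
have /choice[f Hf] (p : W * W) : exists w, A p.1 -> A p.2 -> G (p, w).
  have [[Ap Ap']|no] := EM (A p.1 /\ A p.2).
    by case: p Ap Ap' => a b /= Aa Ab; have [w Gw] := Gt a b Aa Ab; exists w.
  by exists (i 0) => Ap Ap'; case: no.
have fA a b : A a -> A b -> A (f (a, b)).
  by move=> Aa Ab; have [] := Gs _ _ _ (Hf (a, b) Aa Ab).
have fI a b a' b' : A a -> A b -> A a' -> A b' -> f (a, b) = f (a', b') -> a = a' /\ b = b'.
  move=> Aa Ab Aa' Ab' E; have := Hf (a, b) Aa Ab; rewrite E.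
  by move=> /Gi/(_ (Hf (a', b') Aa' Ab'))[].
(* A point of the new field is an element of A or its copy under g; a pair of such
   points is coded by the underlying pair in A and a tag telling which of the two
   points are copies. *)
pose pt (ba : bool * W) := if ba.1 then ba.2 else g ba.2.
have ptI b a b' a' : A a -> A a' -> pt (b, a) = pt (b', a') -> b = b' /\ a = a'.
  move=> Aa Aa'; case: b b' => -[]; rewrite /pt /= => E //.
  - by case: (gA a'); rewrite -?E.
  - by case: (gA a); rewrite ?E.
  - by split=> //; apply: gI.
pose tag (b b' : bool) := i (b + b'.*2).
have tagI b b' c c' : tag b b' = tag c c' -> b = c /\ b' = c'.
  by move=> /iI; case: b; case: b'; case: c; case: c'.
have Af u v b1 b2 : A u -> A v -> A (f (f (u, v), tag b1 b2)).
  by move=> Au Av; exact: fA (fA _ _ Au Av) (iA _).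
pose new := [set q : (W * W) * W | exists b a b' a', [/\ A a, A a', ~~ (b && b') &
  q = ((pt (b, a), pt (b', a')), g (f (f (a, a'), tag b b')))]].
pose G' := G `|` new.
have GA a b w : G ((a, b), w) -> [/\ A a, A b & A w] := Gs a b w.
have fldG' x : fld G' x <-> exists b a, A a /\ x = pt (b, a).
  split=> [[w [/GA[Ax _ _]|[b [a [b' [a' [Aa _ _ [xE _ _]]]]]]]]|[[] [a [Aa ->]]]].
  - by exists true, x.
  - by exists b, a.
  - by have [w Gw] := Gt a a Aa Aa; exists w; left.
  - by exists (g (f (f (a, a), tag false false))); right; exists false, a, false, a.
exists G'; split.
  split; first by move=> q; left.
  move=> /(_ ((g (i 0), g (i 0)), g (f (f (i 0, i 0), tag false false)))) H.
  have [|] := GA (g (i 0)) (g (i 0)) (g (f (f (i 0, i 0), tag false false))).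
    by apply: H; right; exists false, (i 0), false, (i 0).
  by move=> /(gA _ (iA 0)).
have newA b b' a a' w : A a -> A a' -> ~~ (b && b') -> ~ G ((pt (b, a), pt (b', a')), w).
  by case: b b' => -[] /= Aa Aa' bb /GA[] /= => [//|_ /(gA _ Aa')|/(gA _ Aa)|/(gA _ Aa)].
split.
- move=> [x y] w w' [H|[b [a [b' [a' [Aa Aa' bb E]]]]]] [H'|[c [e [c' [e' [Ae Ae' cc E']]]]]].
  + exact: Gf H H'.
  + by case: E' => ??; subst x y; case: (newA _ _ _ _ _ Ae Ae' cc H).
  + by case: E => ??; subst x y; case: (newA _ _ _ _ _ Aa Aa' bb H').
  + case: E E' => -> -> -> [E1 E2 ->].
    by have [-> ->] := ptI _ _ _ _ Aa Ae E1; have [-> ->] := ptI _ _ _ _ Aa' Ae' E2.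
- move=> [x y] [x' y'] w [H|[b [a [b' [a' [Aa Aa' bb E]]]]]] [H'|[c [e [c' [e' [Ae Ae' cc E']]]]]].
  + exact: Gi H H'.
  + case: E' => _ _ wE; have [_ _] := GA _ _ _ H.
    by rewrite wE => Aw; case: (gA _ (Af _ _ _ _ Ae Ae') Aw).
  + case: E => _ _ wE; have [_ _] := GA _ _ _ H'.
    by rewrite wE => Aw; case: (gA _ (Af _ _ _ _ Aa Aa') Aw).
  + case: E E' => -> -> -> [-> -> wE].
    have fE := gI _ _ (Af _ _ _ _ Aa Aa') (Af _ _ _ _ Ae Ae') wE.
    have [ffE tE] := fI _ _ _ _ (fA _ _ Aa Aa') (iA _) (fA _ _ Ae Ae') (iA _) fE.
    have [-> ->] := fI _ _ _ _ Aa Aa' Ae Ae' ffE.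
    by have [-> ->] := tagI _ _ _ _ tE.
- move=> x y w [/GA[Ax Ay Aw]|[b [a [b' [a' [Aa Aa' bb [-> -> ->]]]]]]]; split; apply/fldG'.
  + by exists true, x.
  + by exists true, y.
  + by exists true, w.
  + by exists b, a.
  + by exists b', a'.
  + by exists false, (f (f (a, a'), tag b b')); split=> //; apply: Af.
- move=> x y /fldG'[b [a [Aa ->]]] /fldG'[b' [a' [Aa' ->]]].
  have [bb|bb] := boolP (b && b'); last first.
    by exists (g (f (f (a, a'), tag b b'))); right; exists b, a, b', a'.
  by case/andP: bb => -> ->; have [w Gw] := Gt a a' Aa Aa'; exists w; left.
Qed.

Lemma embeds_square_of : embeds (W * W) W.
Proof.
pose P G := wf G /\ (G = set0 \/ G0 `<=` G).
have [|G [[wG GG0] Gmax]] := @Zorn_bigcup _ P.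
  move=> F FP Ftot; split.
    have two p q : (\bigcup_(X in F) X) p -> (\bigcup_(X in F) X) q ->
        exists X, [/\ F X, X p & X q].
      move=> [X FX Xp] [Y FY Yq]; have [XY|YX] := Ftot X Y FX FY.
        by exists Y; split=> //; apply: XY.
      by exists X; split=> //; apply: YX.
    have up X a : F X -> fld X a -> fld (\bigcup_(X in F) X) a.
      by move=> FX [w Xw]; exists w, X.
    split.
    - move=> p w w' H H'; have [X [/FP[[Xf _ _ _] _] X1 X2]] := two _ _ H H'.
      exact: Xf X1 X2.
    - move=> p p' w H H'; have [X [/FP[[_ Xi _ _] _] X1 X2]] := two _ _ H H'.
      exact: Xi X1 X2.
    - move=> a b w [X FX Xw]; have [[_ _ Xs _] _] := FP _ FX.
      by have [? ? ?] := Xs _ _ _ Xw; split; apply: up FX _.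
    - move=> a b [w Hw] [w' Hw']; have [X [FX X1 X2]] := two _ _ Hw Hw'.
      have [[_ _ _ Xt] _] := FP _ FX.
      have [||z Xz] := Xt a b; [by exists w|by exists w'|].
      by exists z, X.
  have [[X [FX X0]]|no] := EM (exists X, F X /\ X <> set0).
    by right=> q G0q; exists X => //; have [_ [//|]] := FP _ FX; apply.
  left; apply/seteqP; split=> // q [X FX Xq]; apply: no; exists X; split=> //.
  by move=> E; rewrite E in Xq.
have {}GG0 : G0 `<=` G.
  case: GG0 => // GE; exfalso; apply: (Gmax G0); last by split=> //; right.
  rewrite GE; split=> // /(_ ((i 0, i 0), i (pickle (0, 0)))); apply.
  by exists 0, 0.
have natA : embeds nat (fld G).
  have iA n : fld G (i n) by exists (i (pickle (n, n))); apply: GG0; exists n, n.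
  by exists (fun n => SigSub (mem_set (iA n))) => m n [/iI].
have sqA : embeds (fld G * fld G) (fld G).
  have [_ Gi Gs Gt] := wG.
  have /choice[f Hf] (p : fld G * fld G) : exists w : fld G, G ((\val p.1, \val p.2), \val w).
    have [w Gw] := Gt _ _ (set_valP p.1) (set_valP p.2).
    by have [_ _ Aw] := Gs _ _ _ Gw; exists (SigSub (mem_set Aw)).
  exists f => -[a b] [a' b'] E; have := Hf (a, b); rewrite E => /Gi/(_ (Hf (a', b'))).
  by case=> /val_inj-> /val_inj->.
have [CA|AC] := embeds_total (set_type (~` fld G)) (set_type (fld G)); last first.
  have [G' [GG' wG']] := square_extend wG GG0 AC.
  exfalso; apply: (Gmax G') => //; split=> //; right.
  by apply: subset_trans GG0 _; case: GG'.
have WA : embeds W (fld G).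
  apply: embeds_trans (embeds_double natA sqA).
  apply: embeds_trans (embeds_sum_map (embeds_refl _) CA).
  have /choice[f Hf] w : exists u : fld G + ~` fld G,
      match u with inl a => \val a = w | inr a => \val a = w end.
    have [Aw|nAw] := EM (fld G w).
      by exists (inl (SigSub (mem_set Aw))).
    by exists (inr (SigSub (mem_set (nAw : (~` fld G) w)))).
  by exists f => w w' E; have := Hf w; have := Hf w'; rewrite E; case: (f w') => a -> ->.
apply: embeds_trans (embeds_prod WA WA) _; apply: embeds_trans sqA _.
by exists val; apply: val_inj.
Qed.

End Square.

Lemma embeds_square (W : Type) : embeds nat W -> embeds (W * W) W.
Proof. by move=> [i iI]; apply: embeds_square_of iI. Qed.

(** The length of a sequence, together with its image under iterated pairing,
   determines it. *)
Lemma embeds_seq (W : Type) : embeds nat W -> embeds (seq W) W.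
Proof.
move=> natW; have WW := embeds_square natW; have [pi piI] := WW.
apply: embeds_trans WW; apply: embeds_trans (embeds_prod natW (embeds_refl W)).
have [i _] := natW.
exists (fun l => (size l, foldr (fun x acc => pi (x, acc)) (i 0) l)).
by elim=> [|x l IH] [|y l'] //= [sz /piI[-> E]]; congr cons; apply: IH; rewrite sz E.
Qed.

(** * Well-orders *)

Definition strict (T : Type) (R : rel T) (x y : T) : Prop := R x y /\ x <> y.

Record strict_well_order (T : Type) (lt : T -> T -> Prop) : Prop := StrictWellOrder {
  swo_wf : well_founded lt;
  swo_trans : forall s t u, lt s t -> lt t u -> lt s u;
  swo_total : forall s t, [\/ lt s t, s = t | lt t s] }.

Section WellOrder.
Variables (T : Type) (R : rel T).
Hypothesis woR : well_order R.

Lemma wo_min (A : set T) : A !=set0 -> exists2 z, A z & forall x, A x -> R z x.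
Proof.
move=> [x Ax]; have [|z [[Az zmin] _]] := woR (A := fun z => `[< A z >]).
  by exists x; apply/asboolP.
exists z; first by apply/asboolP.
by move=> y Ay; apply: zmin; apply/asboolP.
Qed.

Lemma wo_total (x y : T) : R x y \/ R y x.
Proof.
have [|z [->|->] H] := @wo_min [set z | z = x \/ z = y]; first by exists x; left.
  by left; apply: H; right.
by right; apply: H; left.
Qed.

Lemma wo_refl (x : T) : R x x.
Proof. by case: (wo_total x x). Qed.

Lemma wo_anti (x y : T) : R x y -> R y x -> x = y.
Proof.
move=> xy yx; have [|z [_ zU]] := woR (A := fun z => `[< z = x \/ z = y >]).
  by exists x; apply/asboolP; left.
transitivity z; [apply: esym|]; apply: zU; split.
- by apply/asboolP; left.
- by move=> w /asboolP[->|->]; [apply: wo_refl|].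
- by apply/asboolP; right.
- by move=> w /asboolP[->|->]; [|apply: wo_refl].
Qed.

Lemma wo_trans (x y z : T) : R x y -> R y z -> R x z.
Proof.
move=> xy yz; have [|m mE H] := @wo_min [set w | [\/ w = x, w = y | w = z]].
  by exists x; apply: Or31.
have Hx : R m x by apply: H; apply: Or31.
have Hy : R m y by apply: H; apply: Or32.
have Hz : R m z by apply: H; apply: Or33.
case: mE => E; subst m => //; first by rewrite (wo_anti xy Hx).
by rewrite -(wo_anti yz Hy).
Qed.

Lemma wo_strict : strict_well_order (strict R).
Proof.
split.
- move=> x; apply: contrapT => nx.
  have [|z nz zmin] := @wo_min [set x | ~ Acc (strict R) x]; first by exists x.
  apply: nz; constructor => y [yz ne]; apply: contrapT => ny.
  by apply: ne; apply: wo_anti yz (zmin y ny).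
- move=> x y z [xy nxy] [yz nyz]; split; first exact: wo_trans yz.
  by move=> E; subst z; apply: nxy; apply: wo_anti.
- move=> x y; have [->|ne] := EM (x = y); first exact: Or32.
  have [?|?] := wo_total x y; [apply: Or31|apply: Or33]; split=> // E; exact: ne.
Qed.

Lemma wo_leNgt (x y : T) : ~ R x y -> strict R y x.
Proof.
move=> nxy; have [//|yx] := wo_total x y; split=> // E.
by apply: nxy; rewrite E; apply: wo_refl.
Qed.

End WellOrder.

Definition lexi (A B : Type) (ltA : A -> A -> Prop) (ltB : B -> B -> Prop)
    (p q : A * B) : Prop :=
  ltA p.1 q.1 \/ (p.1 = q.1 /\ ltB p.2 q.2).

Lemma strict_well_order_lexi (A B : Type) (ltA : A -> A -> Prop) (ltB : B -> B -> Prop) :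
  strict_well_order ltA -> strict_well_order ltB -> strict_well_order (lexi ltA ltB).
Proof.
move=> [wfA trA toA] [wfB trB toB]; split.
- move=> [a b]; elim/(well_founded_ind wfA): a b => a IHa b.
  elim/(well_founded_ind wfB): b => b IHb.
  by constructor => -[a' b'] [/= /IHa//|[/= -> /IHb]].
- move=> [a b] [a' b'] [a'' b''] [/= h|[/= -> h]] [/= h'|[/= <- h']].
  + by left; apply: trA h'.
  + by left.
  + by left.
  + by right; split=> //; apply: trB h'.
- move=> [a b] [a' b']; have [h|->|h] := toA a a'; first by apply: Or31; left.
    have [h|->|h] := toB b b'; [apply: Or31|exact: Or32|apply: Or33]; by right.
  by apply: Or33; left.
Qed.

Lemma strict_well_order_inj (A B : Type) (f : A -> B) (lt : B -> B -> Prop) :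
  injective f -> strict_well_order lt -> strict_well_order (fun a b => lt (f a) (f b)).
Proof.
move=> fI [wf tr to]; split.
- move=> a; move E: (f a) => b; elim/(well_founded_ind wf): b a E => b IH a E.
  by constructor => a' h; apply: (IH (f a')) => //; rewrite -E.
- by move=> a b c; apply: tr.
- move=> a b; have [h|/fI ->|h] := to (f a) (f b); [exact: Or31|exact: Or32|exact: Or33].
Qed.

Lemma exists_strict_well_order (T : Type) : exists lt : T -> T -> Prop, strict_well_order lt.
Proof.
have [R woR] := well_ordering_principle {classic T}.
by exists (strict (T := T) R); apply: wo_strict.
Qed.

(** * Cofinality *)

Lemma card_lt_embeds (T U : Type) (A : set T) :
  card_lt A [set: U] <-> embeds (set_type A) U /\ ~ embeds U (set_type A).
Proof.
have eU := embeds_val [set: U]; have eU' := set_type_setT U.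
rewrite /card_lt !card_le_embeds; split=> -[h h']; split.
- exact: embeds_trans eU.
- by move=> h2; apply: h'; apply: embeds_trans h2.
- exact: embeds_trans eU'.
- by move=> h2; apply: h'; apply: embeds_trans h2.
Qed.

Lemma sval_inj (T : Type) (P : T -> Prop) : injective (@sval T P).
Proof. by move=> [x px] [y py] /= E; apply: eq_exist. Qed.

Lemma embeds_sub (T : Type) (A B : set T) : A `<=` B -> embeds {x | A x} {x | B x}.
Proof.
move=> AB; exists (fun x => exist B (sval x) (AB _ (svalP x))) => x y [].
exact: sval_inj.
Qed.

Lemma embeds_sig (T : Type) (A : set T) : embeds {x | A x} (set_type A).
Proof.
by exists (fun x => SigSub (mem_set (svalP x))) => x y [] /sval_inj.
Qed.

Lemma initial_small (kappa : cardinal) (x : kappa) :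
  ~ embeds kappa {y | strict (@cle kappa) y x}.
Proof.
have /card_lt_embeds[_ h] := cle_initial x => h'; apply: h.
exact: embeds_trans h' (embeds_sig _).
Qed.

Section Cofinality.
Variables (kappa lambda : cardinal).
Hypothesis cof : is_cof kappa lambda.

Lemma cof_sequence : exists f : lambda -> kappa, injective f /\ forall x, exists i, cle x (f i).
Proof.
have [[C [Ccof CE]] _] := cof; move: CE; rewrite card_eq_sym => /card_bijP[g [h gK hK]].
pose i (l : lambda) : set_type [set: lambda] := SigSub (mem_set (Logic.I : [set: lambda] l)).
exists (fun l => \val (g (i l))); split.
  by move=> x y /val_inj/(can_inj gK)[].
move=> x; have [y Cy xy] := Ccof x.
exists (\val (h (SigSub (mem_set Cy)))).
suff -> : i (\val (h (SigSub (mem_set Cy)))) = h (SigSub (mem_set Cy)) by rewrite hK.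
exact: val_inj.
Qed.

Lemma bounded_small (S : Type) (b : S -> kappa) :
  ~ embeds lambda S -> exists x, forall s, strict (@cle kappa) (b s) x.
Proof.
move=> nS; have [_ /(_ (range b))] := cof.
have [bcof|/existsNP[x nx]] := EM (cofinal (range b)).
  move=> /(_ bcof)/card_le_embeds h; case: nS.
  apply: embeds_trans (embeds_trans (set_type_setT lambda) h) _.
  have /choice[r Hr] (y : set_type (range b)) : exists s, b s = \val y.
    by have [s _ <-] := set_valP y; exists s.
  by exists r => y y' E; apply: val_inj; rewrite -!Hr E.
move=> _; exists x => s; apply: (wo_leNgt (@cle_wo kappa)) => xs.
by apply: nx; exists (b s) => //; exists s.
Qed.

(** Regularity of the cofinality: each fibre of [f] is bounded in [kappa], and so
   is the family of these bounds, whereas [lambda] is sent to a cofinal set. *)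
Lemma cof_regular (J : Type) (f : lambda -> J) :
  ~ embeds lambda J -> ~ forall j, ~ embeds lambda {i | f i = j}.
Proof.
move=> nJ small.
have [g [gI gcof]] := cof_sequence.
have /choice[b Hb] j : exists x, forall s : {i | f i = j}, strict (@cle kappa) (g (sval s)) x.
  exact: bounded_small.
have [x Hx] := bounded_small b nJ.
have [i xi] := gcof x.
have [gib ne] := Hb (f i) (exist _ i erefl); have [bx nbx] := Hx (f i).
have wo := @cle_wo kappa.
by apply: nbx; apply: (wo_anti wo) => //; apply: (wo_trans wo xi).
Qed.

Lemma cof_prod (A B : Type) :
  ~ embeds lambda A -> ~ embeds lambda B -> ~ embeds lambda (A * B).
Proof.
move=> nA nB [f fI]; apply: (cof_regular (f := fun i => (f i).2)) nB _ => b.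
move=> [g gI]; apply: nA; exists (fun i => (f (sval (g i))).1) => i j E.
apply/gI/sval_inj/fI; case: (g i) (g j) E => i' /= Ei [j' /= Ej].
by case: (f i') Ei (f j') Ej => ? ? /= -> [? ?] /= -> ->.
Qed.

Hypothesis lambda_uncountable : ~ embeds lambda nat.

Lemma cof_sum (A B : Type) :
  ~ embeds lambda A -> ~ embeds lambda B -> ~ embeds lambda (A + B).
Proof.
move=> nA nB [f fI].
have nbool : ~ embeds lambda bool.
  by move=> h; apply: lambda_uncountable; apply: embeds_trans h (embeds_countType _).
apply: (cof_regular (f := fun i => if f i is inl _ then true else false)) nbool _.
case=> -[g gI].
  apply: nA; have /choice[r Hr] i : exists a, f (sval (g i)) = inl a.
    by case: (g i) => j /=; case: (f j) => // a _; exists a.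
  by exists r => i j E; apply/gI/sval_inj/fI; rewrite !Hr E.
apply: nB; have /choice[r Hr] i : exists b, f (sval (g i)) = inr b.
  by case: (g i) => j /=; case: (f j) => // b _; exists b.
by exists r => i j E; apply/gI/sval_inj/fI; rewrite !Hr E.
Qed.

Lemma cof_bigcup (J : Type) (S : J -> set lambda) :
  ~ embeds lambda J -> (forall j, ~ embeds lambda {i | S j i}) ->
  ~ embeds lambda {i | (\bigcup_j S j) i}.
Proof.
move=> nJ small [f fI].
have /choice[k Hk] i : exists j, S j (sval (f i)).
  by have [j _ Sj] := svalP (f i); exists j.
apply: (cof_regular (f := k)) nJ _ => j [g gI]; apply: (small j).
have H i : S j (sval (f (sval (g i)))) by have := Hk (sval (g i)); rewrite (svalP (g i)).
exists (fun i => exist (S j) _ (H i)) => i i' E.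
by apply/gI/sval_inj/fI/sval_inj; case: E.
Qed.

End Cofinality.

(** * Existence of typical tuples *)

Definition closed_cup (I : Type) (J : set (set I)) (X : Type) : Prop :=
  forall F : X -> set I, (forall a, J (F a)) -> J (\bigcup_a F a).

(** The conditions that define typical tuples over a family indexed by [Q]: a
   formula, and an index for each of its parameters. *)
Definition instances (L : language) (d : nat) (Q : Type) : Type :=
  {a : {k : nat & formula L ('I_d + 'I_k)} & 'I_(projT1 a) -> Q}.

Lemma formulas_countable (L : language) (d : nat) :
  countable_language L -> embeds {k : nat & formula L ('I_d + 'I_k)} nat.
Proof.
move=> cL; pose code k := cid (formula_countable cL (embeds_countType ('I_d + 'I_k)%type)).
apply: (@embeds_trans _ (nat * nat)); last exact: embeds_countType.
exists (fun a => (projT1 a, projT1 (code _) (projT2 a))) => -[k u] [k' u'] /= [kk].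
by move: u'; rewrite -{}kk => u' /(projT2 (code k)) ->.
Qed.

Lemma instances_embeds (L : language) (d : nat) (Q W : Type) :
  countable_language L -> embeds nat W -> embeds Q W -> embeds (instances L d Q) W.
Proof.
move=> cL natW QW.
have WW := embeds_square natW.
have SW : embeds (seq Q) W.
  apply: embeds_trans (embeds_seq natW); have [f fI] := QW.
  by exists (map f); apply: inj_map.
apply: embeds_trans (embeds_trans (embeds_prod natW SW) WW).
apply: embeds_trans (embeds_prod (formulas_countable d cL) (embeds_refl (seq Q))).
exists (fun a : instances L d Q => (projT1 a, codom (projT2 a))) => -[a e] [a' e'] /= [aa].
by move: e'; rewrite -{}aa => e' /map_enum_inj ->.
Qed.

(** For the filter of a set [S] modulo [J], the tuples of [S] failing a given
   condition form a set of [J]; the conditions are not too many to join these. *)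
Lemma atypical_small (L : language) (M : fo_structure L) (d : nat) (I Q : Type)
    (J : set (set I)) (x : I -> ('I_d -> M)) (S : set ('I_d -> M)) (b : Q -> M) :
  sigma_ideal J -> closed_cup J (instances L d Q) ->
  J [set i | S (x i) /\ ~ typical [set Z | J (x @^-1` (S `\` Z))] (range b) (x i)].
Proof.
move=> [J0 Jsub _ _] Jcup.
pose p : set (set ('I_d -> M)) := [set Z | J (x @^-1` (S `\` Z))].
pose F (a : instances L d Q) := [set i | p (dset (projT2 (projT1 a)) (b \o projT2 a)) /\
  (S `\` dset (projT2 (projT1 a)) (b \o projT2 a)) (x i)].
have JF a : J (F a).
  have [pa|npa] := EM (p (dset (projT2 (projT1 a)) (b \o projT2 a))).
    by apply: Jsub pa => i [].
  by apply: Jsub J0 => i [].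
apply: Jsub (Jcup F JF) => i [Si nt]; apply: contrapT => no; apply: nt => k psi e be ppsi.
have /choice[g Hg] j : exists v, b v = e j by have [v _ <-] := be j; exists v.
have eE : e = b \o g by apply/funext => j /=; rewrite Hg.
apply: contrapT => nx; apply: no; exists (existT _ (existT _ k psi) g) => //.
by split; rewrite /= -eE.
Qed.

(** * Indiscernible parameters *)

Section Lambda.
Variables (L : language) (T : set (sentence L)) (M : fo_structure L).
Hypotheses (cL : countable_language L) (st : omega_stable T) (MT : is_model T M)
  (hM : homogeneous M).
Variables (kappa lambda : cardinal).
Hypotheses (cof : is_cof kappa lambda) (lambda_unc : ~ embeds lambda nat).

Lemma nat_embeds_lambda : embeds nat lambda.
Proof. by have [] := embeds_total nat lambda. Qed.

Lemma small_instances (d : nat) (Q : Type) : ~ embeds lambda Q -> ~ embeds lambda (instances L d Q).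
Proof.
move=> nQ lI; have [natQ|Qnat] := embeds_total nat Q.
  by apply: nQ; exact: (embeds_trans lI (instances_embeds d cL natQ (embeds_refl Q))).
by apply: lambda_unc; exact: (embeds_trans lI (instances_embeds d cL (embeds_refl nat) Qnat)).
Qed.

(** The filter [q] given by the family [c] modulo the sets of fewer than [lambda]
   indices has parameters [c'] of its own. The [h a] are chosen by recursion so
   that [c (h a)] is typical for [q] over [iota], [c'] and the previous choices; a
   single filter is involved, hence a single block. *)
Lemma indiscernible_parameters (n : nat) (I0 : set lambda) (c : lambda -> 'I_n -> M)
    (P : Type) (iota : P -> M) :
  ~ embeds lambda P -> embeds lambda {i | I0 i} ->
  exists h : lambda -> lambda, [/\ injective h, forall a, I0 (h a) &
    forall (k m : nat) (a a' : 'I_k -> lambda) (r : 'I_m -> P),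
      (forall i j, a i = a j <-> a' i = a' j) ->
      equi (sumf (iota \o r) (fun ij : 'I_k * 'I_n => c (h (a ij.1)) ij.2))
           (sumf (iota \o r) (fun ij : 'I_k * 'I_n => c (h (a' ij.1)) ij.2))].
Proof.
move=> nP lI0.
pose J (S : set lambda) := ~ embeds lambda {i | I0 i /\ S i}.
have Jsub A B : A `<=` B -> J B -> J A.
  move=> AB JB h; apply: JB; apply: embeds_trans h _.
  by apply: embeds_sub => i [I0i /AB].
have [i0 _] := nat_embeds_lambda.
have J0 : J set0 by move=> [f _]; case: (svalP (f (i0 0))).
have Jcup X : ~ embeds lambda X -> closed_cup J X.
  move=> nX F JF h; have := cof_bigcup cof nX JF; apply.
  apply: embeds_trans h _; apply: embeds_sub => i [I0i [j _ Fj]].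
  by exists j.
have sJ : sigma_ideal J.
  split=> // [A JA|]; first exact: Jcup lambda_unc _ JA.
  by apply; apply: embeds_trans lI0 _; apply: embeds_sub => i.
have [S [nJS gq]] := generic_of_ideal c st MT sJ.
set q := [set Z | _] in gq.
have [n' [phi [c' cq]]] := generic_coded st MT gq.
have uq : uniform_rule c' c' q q.
  by move=> V psi e e' Vnat; exact: (coded_uniform hM cq cq Vnat).
pose lt := strict (@cle lambda).
have [lt_wf lt_tr lt_to] := wo_strict (@cle_wo lambda).
pose B := range iota `|` range c'.
pose good (a : lambda) (f : lambda -> lambda) (i : lambda) :=
  [/\ I0 i, typical q (B `|` coords (c \o f) [set b | lt b a]) (c i) &
      forall b, lt b a -> f b <> i].
have [||a f|h Hh] := @wf_choice _ _ lt good lt_wf.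
- by constructor; apply: i0 0.
- move=> a f g i fg [I0i ti fi]; split=> // [|b ba]; last by rewrite -fg //; apply: fi.
  apply: typical_sub ti => x [Bx|[b ba xb]]; first by left.
  by right; exists b => //; move: xb; rewrite /= fg.
- pose Q : Type := (P + 'I_n' + {b | lt b a} * 'I_n)%type.
  have nfin k : ~ embeds lambda 'I_k.
    by move=> h; apply: lambda_unc; apply: embeds_trans h (embeds_countType _).
  have nlt : ~ embeds lambda {b | lt b a} := @initial_small lambda a.
  have nQ : ~ embeds lambda Q.
    by apply: (cof_sum cof lambda_unc); [apply: (cof_sum cof)|apply: (cof_prod cof)].
  pose b (v : Q) : M := match v with
    | inl (inl p) => iota p | inl (inr j) => c' j
    | inr (u, j) => c (f (sval u)) j end.
  have bad1 := @atypical_small L M n lambda Q J c S b sJ (Jcup _ (small_instances nQ)).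
  have bad2 : J [set i | exists2 u, lt u a & f u = i].
    move=> h; apply: nlt; apply: embeds_trans h _.
    have /choice[r Hr] (i : {i | I0 i /\ exists2 u, lt u a & f u = i}) :
        exists u : {u | lt u a}, f (sval u) = sval i.
      by have [_ [u ua fu]] := svalP i; exists (exist _ u ua).
    by exists r => i j E; apply: sval_inj; rewrite -!Hr E.
  apply: contrapT => no; apply: nJS.
  have := @ideal_cup _ _ sJ (fun k => if k is 0 then _ else _) (fun k =>
     match k return J (if k is 0 then _ else _) with 0 => bad1 | _.+1 => bad2 end).
  move=> bad h; apply: bad; apply: embeds_trans h _; apply: embeds_sub => i [I0i Si]; split=> //.
  have [[u ua fu]|nf] := EM (exists2 u, lt u a & f u = i); first by exists 1 => //; exists u.
  exists 0 => //; split=> // ti; apply: no; exists i; split=> //.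
    apply: typical_sub ti => x [[[p _ <-]|[j _ <-]]|[u ua [j _ <-]]].
    + by exists (inl (inl p)).
    + by exists (inl (inr j)).
    + by exists (inr (exist _ u ua, j)).
  by move=> u ua fu; apply: nf; exists u.
exists h; split=> [a b hab|a|k m a a' r aa'].
- have [ab|//|ba] := lt_to a b.
    by have [_ _ /(_ _ ab)/(_ hab)] := Hh b.
  by have [_ _ /(_ _ ba)/(_ (esym hab))] := Hh a.
- by case: (Hh a).
have ty t : typical q (B `|` coords (c \o h) [set s | s <> t]) (c (h t)).
  apply: (typical_unordered cL st MT lt_wf lt_tr lt_to (p := fun=> q) (c := fun=> c')) t => //.
    by move=> _; right.
  by move=> t; have [] := Hh t.
pose e := sumf (iota \o r) c'.
have Be w : B (e w).
  by case: w => j; [left; exists (r j)|right; exists j].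
have E : equi (sumf e (fun ij : 'I_k * 'I_n => (c \o h) (a ij.1) ij.2))
              (sumf e (fun ij : 'I_k * 'I_n => (c \o h) (a' ij.1) ij.2)).
  apply: (@typical_family_equi L M lambda n n' (fun=> q) (fun=> c') (c \o h) B
    _ e e k a a' (fun=> inr)) => //.
  exact: embeds_countType.
pose g (v : 'I_m + 'I_k * 'I_n) : ('I_m + 'I_n') + 'I_k * 'I_n :=
  match v with inl j => inl (inl j) | inr w => inr w end.
have F u : sumf (iota \o r) u = sumf e u \o g by apply/funext => -[].
by rewrite !F; apply: equi_comp.
Qed.

End Lambda.

(** * Blocks of typical tuples *)

Lemma embeds_bigcup (I X W : Type) (F : X -> set I) :
  embeds X W -> embeds nat W -> (forall a, embeds {i | F a i} W) ->
  embeds {i | (\bigcup_a F a) i} W.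
Proof.
move=> XW natW FW; apply: embeds_trans (embeds_square natW).
apply: embeds_trans (embeds_prod XW (embeds_refl W)).
pose g a := projT1 (cid (FW a)).
have gI a : injective (g a) := projT2 (cid (FW a)).
have /choice[k Hk] (u : {i | (\bigcup_a F a) i}) : exists a, F a (sval u).
  by have [a _ Fa] := svalP u; exists a.
exists (fun u => (k u, g (k u) (exist _ (sval u) (Hk u)))) => u v [kE].
move: (Hk u); rewrite kE => Fu E; apply: sval_inj.
have /gI[] : g (k v) (exist _ (sval u) Fu) = g (k v) (exist _ (sval v) (Hk v)).
  by rewrite -E; congr g; apply: sval_inj.
by [].
Qed.

Section Levels.
Variables (kappa lambda : cardinal).
Hypotheses (cof : is_cof kappa lambda) (lambda_unc : ~ embeds lambda nat)
  (lambda_lt : ~ embeds kappa lambda).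

(** The bounds of the blocks: [W i] is [lambda] together with the elements of
   [kappa] below some [f j] with [j <= i], for a cofinal sequence [f]. Including
   [lambda] makes room for all the parameters of the filters. *)
Lemma cof_levels :
  exists W : lambda -> set (lambda + kappa),
    [/\ forall i j, cle i j -> W i `<=` W j,
        forall i j, W i (inl j),
        forall y, exists i, W i (inr y) &
        forall i, ~ embeds kappa {z | W i z}].
Proof.
have natl := nat_embeds_lambda lambda_unc.
have [f [_ fcof]] := cof_sequence cof.
have wok := @cle_wo kappa; have wol := @cle_wo lambda.
pose seg (i : lambda) : set kappa := [set y | exists2 j, cle j i & cle y (f j)].
pose inW (i : lambda) (z : lambda + kappa) := if z is inr y then seg i y else True.
have small_le i : ~ embeds lambda {j : lambda | cle j i}.
  move=> h; apply: (cof_sum cof lambda_unc (@initial_small lambda i)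
    (fun h : embeds lambda unit => lambda_unc (embeds_trans h (embeds_countType _)))).
  apply: embeds_trans h _.
  have /choice[r Hr] (j : {j : lambda | cle j i}) : 
      exists v : {j | strict (@cle lambda) j i} + unit,
      if v is inl u then sval u = sval j else sval j = i.
    have [E|ne] := EM (sval j = i); first by exists (inr tt).
    by exists (inl (exist _ (sval j) (conj (svalP j) ne))).
  exists r => j j' E; apply: sval_inj; have := Hr j; have := Hr j'; rewrite E.
  by case: (r j') => [u <- <-|_ -> ->].
have kW i : ~ embeds kappa {z | inW i z}.
  have nseg : ~ embeds kappa {y | seg i y}.
    have [z Hz] := bounded_small cof (fun j : {j : lambda | cle j i} => f (sval j)) (small_le i).
    move=> h; apply: (@initial_small kappa z); apply: embeds_trans h _.
    apply: embeds_sub => y [j ji yj]; have [fz ne] := Hz (exist _ j ji); split.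
      exact: (wo_trans wok yj fz).
    by move=> E; subst y; apply: ne; apply: (wo_anti wok).
  have Wsum : embeds {z | inW i z} (lambda + {y | seg i y}).
    have /choice[r Hr] (z : {z | inW i z}) : exists v : lambda + {y | seg i y},
        sval z = match v with inl j => inl j | inr y => inr (sval y) end.
      case: z => -[j|y] /= zP; first by exists (inl j).
      by exists (inr (exist _ y zP)).
    by exists r => z z' E; apply: sval_inj; rewrite Hr E -Hr.
  move=> h; have {}h := embeds_trans h Wsum.
  have [lS|Sl] := embeds_total lambda {y | seg i y}.
    have nS := embeds_trans natl lS.
    apply: nseg; apply: embeds_trans h _.
    apply: embeds_trans (embeds_sum_map lS (embeds_refl _)) _.
    exact: embeds_double nS (embeds_square nS).
  apply: lambda_lt; apply: embeds_trans h _.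
  apply: embeds_trans (embeds_sum_map (embeds_refl _) Sl) _.
  exact: embeds_double natl (embeds_square natl).
exists inW; split=> // [i j ij [//|y] [l li yl]|y].
  by exists l => //; exact: (wo_trans wol li ij).
by have [i yi] := fcof y; exists i; exists i => //; apply: wo_refl wol _.
Qed.

End Levels.

Section Blocks.
Variables (L : language) (T : set (sentence L)) (M : fo_structure L).
Hypotheses (cL : countable_language L) (st : omega_stable T) (MT : is_model T M)
  (hM : homogeneous M).
Variables (kappa lambda : cardinal).
Hypotheses (cof : is_cof kappa lambda) (lambda_unc : ~ embeds lambda nat)
  (lambda_lt : ~ embeds kappa lambda).
Variables (d : nat) (I P : Type) (x : I -> 'I_d -> M) (iota : P -> M).
Hypotheses (nP : ~ embeds lambda P) (kI : embeds kappa I).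

Let natl : embeds nat lambda := nat_embeds_lambda lambda_unc.

(** Each class is the block of one of the filters kept by [indiscernible_parameters],
   and has as many elements as the bound of that filter. Ordering the blocks by the
   original indices of the filters makes the bounds monotone along the blocks: no
   more elements precede a tuple than the bound of its block, few enough for a new
   typical tuple to exist. *)
Lemma generic_blocks :
  exists (Th : Type) (cls : Th -> lambda) (h : Th -> I),
    [/\ injective h, embeds Th kappa, embeds kappa Th,
        forall t, embeds nat {s | cls s = cls t} &
        forall (k m : nat) (t t' : 'I_k -> Th) (r : 'I_m -> P),
          injective t -> injective t' ->
          (forall i j, cls (t i) = cls (t j) <-> cls (t' i) = cls (t' j)) ->
          equi (sumf (iota \o r) (fun ij : 'I_k * 'I_d => x (h (t ij.1)) ij.2))
               (sumf (iota \o r) (fun ij : 'I_k * 'I_d => x (h (t' ij.1)) ij.2))].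
Proof.
have wol := @cle_wo lambda.
have [inW [inW_mono inWl inWk kW]] := cof_levels cof lambda_unc lambda_lt.
pose W i : Type := {z | inW i z}.
have lW i : embeds lambda (W i).
  by exists (fun j => exist (inW i) (inl j) (inWl i j)) => j j' [].
have natW i : embeds nat (W i) := embeds_trans natl (lW i).
pose J (i : lambda) (S : set I) := embeds {a | S a} (W i).
have Jsub i A B : A `<=` B -> J i B -> J i A.
  by move=> AB; apply: embeds_trans; apply: embeds_sub.
have J0 i : J i set0.
  by have [g _] := lW i; exists (fun a : {a : I | set0 a} => False_rect _ (svalP a)) => -[].
have Jcup i X : embeds X (W i) -> closed_cup (J i) X.
  by move=> XW F JF; apply: embeds_bigcup.
have nJT i : ~ J i [set: I].
  move=> h; apply: (kW i); apply: embeds_trans kI (embeds_trans _ h).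
  by exists (fun a => exist _ a Logic.I) => a b [].
have sJ i : sigma_ideal (J i).
  split; [exact: J0|exact: Jsub| |exact: nJT].
  by move=> A JA; apply: (Jcup i nat).
have /choice[S HS] i := generic_of_ideal x st MT (sJ i).
pose p i : set (set ('I_d -> M)) := [set Z | J i (x @^-1` (S i `\` Z))].
have gp i : generic_filter (p i) by case: (HS i).
(* There are only countably many formulas, and lambda is regular and uncountable. *)
have [n [phi lI0]] : exists n (phi : formula L ('I_d + 'I_n)),
    embeds lambda {i | exists c, coded phi c (p i)}.
  apply: contrapT => no.
  pose code := {n : nat & formula L ('I_d + 'I_n)}.
  have ncode : ~ embeds lambda code.
    by move=> h; apply: lambda_unc; apply: embeds_trans h (formulas_countable d cL).
  have /choice[g Hg] i : exists a : code, exists c, coded (projT2 a) c (p i).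
    have [n [phi [c Hc]]] := generic_coded st MT (gp i).
    by exists (existT _ n phi), c.
  apply: (cof_regular cof (f := g) ncode) => -[n phi] h; apply: no; exists n, phi.
  apply: embeds_trans h _; apply: embeds_sub => i gi.
  by have := Hg i; rewrite gi.
have [m0] := carrier_inhabited M.
have /choice[c Hc] i : exists c, (exists c, coded phi c (p i)) -> coded phi c (p i).
  have [[c Hc]|no] := EM (exists c, coded phi c (p i)); first by exists c.
  by exists (fun=> m0) => /no.
have [h [hI hI0 hE]] := indiscernible_parameters cL st MT hM cof lambda_unc c iota nP lI0.
have up a b : uniform_rule (c (h a)) (c (h b)) (p (h a)) (p (h b)).
  move=> V psi e e' Vnat.
  exact: (coded_uniform hM (Hc _ (hI0 a)) (Hc _ (hI0 b)) Vnat).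
have [ltk ltk_wo] := exists_strict_well_order (lambda + kappa)%type.
pose Th := {q : lambda * (lambda + kappa) | inW (h q.1) q.2}.
pose cls (t : Th) := (sval t).1.
pose key (t : Th) := h (cls t).
pose lt (s t : Th) := lexi (strict (@cle lambda)) ltk (key s, (sval s).2) (key t, (sval t).2).
have [lt_wf lt_tr lt_to] : strict_well_order lt.
  apply: (strict_well_order_inj (f := fun t : Th => (key t, (sval t).2)));
    last exact: strict_well_order_lexi (wo_strict wol) ltk_wo.
  by move=> s t [/hI k1 k2]; apply: sval_inj; apply: injective_projections.
have le_key s t : lt s t -> cle (key s) (key t).
  by case=> [[]//|[/= -> _]]; apply: wo_refl wol _.
have Wsum i A B : embeds A (W i) -> embeds B (W i) -> embeds (A + B) (W i).
  move=> AW BW; apply: embeds_trans (embeds_sum_map AW BW) _.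
  exact: embeds_double (natW i) (embeds_square (natW i)).
have Wprod i A B : embeds A (W i) -> embeds B (W i) -> embeds (A * B) (W i).
  by move=> AW BW; exact: (embeds_trans (embeds_prod AW BW) (embeds_square (natW i))).
have Wfin i k : embeds 'I_k (W i) := embeds_trans (embeds_countType _) (natW i).
have Wlt t : embeds {s | lt s t} (W (key t)).
  apply: embeds_trans (Wprod _ _ _ (lW (key t)) (embeds_refl _)).
  have H (s : {s | lt s t}) : inW (key t) (sval (sval s)).2.
    case: s => -[[a z] /= zP] lst /=.
    exact: inW_mono (le_key _ _ lst) _ zP.
  exists (fun s => (cls (sval s), exist (inW (key t)) _ (H s))) => s s' [E1 E2].
  by apply/sval_inj/sval_inj/injective_projections.
have PW i : embeds P (W i).
  by have [lP|Pl] := embeds_total lambda P; [case: nP|exact: embeds_trans (lW i)].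
pose B : set M := range iota `|` [set m | exists i, range (c i) m].
pose good (t : Th) (y : Th -> I) (a : I) :=
  typical (p (key t)) (B `|` coords (x \o y) [set s | lt s t]) (x a) /\
  forall s, lt s t -> y s <> a.
have [||t|y Hy] := @wf_choice Th I lt good lt_wf.
- have [g _] := cof_sequence cof; case: natl => i0 _; case: kI => k _.
  by constructor; exact: k (g (i0 0)).
- move=> t y y' a yy' [ta ya]; split; last by move=> s lst; rewrite -yy' //; apply: ya.
  apply: typical_sub ta => m [Bm|[s lst sm]]; first by left.
  by right; exists s => //; move: sm; rewrite /= yy'.
- move=> y; set i := key t.
  pose Q : Type := (P + lambda * 'I_n + {s | lt s t} * 'I_d)%type.
  have QW : embeds Q (W i) := Wsum i _ _
    (Wsum i _ _ (PW i) (Wprod i _ _ (lW i) (Wfin i n))) (Wprod i _ _ (Wlt t) (Wfin i d)).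
  pose b (v : Q) : M := match v with
    | inl (inl u) => iota u | inl (inr (j, k)) => c j k
    | inr (u, j) => x (y (sval u)) j end.
  have QI := Jcup i _ (instances_embeds d cL (natW i) QW).
  have bad1 := @atypical_small L M d I Q (J i) x (S i) b (sJ i) QI.
  have bad2 : J i [set a | exists2 s, lt s t & y s = a].
    apply: embeds_trans (Wlt t).
    have /choice[r Hr] (a : {a | exists2 s, lt s t & y s = a}) :
        exists s : {s | lt s t}, y (sval s) = sval a.
      by have [s lst ys] := svalP a; exists (exist _ s lst).
    by exists r => a a' E; apply: sval_inj; rewrite -!Hr E.
  apply: contrapT => no; have [nJS _] := HS i; apply: nJS.
  have := @ideal_cup _ _ (sJ i) (fun k => if k is 0 then _ else _) (fun k =>
     match k return J i (if k is 0 then _ else _) with 0 => bad1 | _.+1 => bad2 end).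
  apply: Jsub => a Sa.
  have [[s lst ys]|ny] := EM (exists2 s, lt s t & y s = a); first by exists 1 => //; exists s.
  exists 0 => //; split=> // ta; apply: no; exists a; split.
    apply: typical_sub ta => m [[[u _ <-]|[j [k _ <-]]]|[s lst [j _ <-]]].
    + by exists (inl (inl u)).
    + by exists (inl (inr (j, k))).
    + by exists (inr (exist _ s lst, j)).
  by move=> s lst ys; apply: ny; exists s.
exists Th, cls, y; split.
- move=> s t E; have [lst|//|lts] := lt_to s t.
    by have [_ /(_ _ lst)/(_ E)] := Hy t.
  by have [_ /(_ _ lts)/(_ (esym E))] := Hy s.
- have lk : embeds lambda kappa by have [|/lambda_lt] := embeds_total lambda kappa.
  have nk := embeds_trans natl lk; have kk := embeds_square nk.
  have sk : embeds (lambda + kappa) kappa.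
    exact: embeds_trans (embeds_sum_map lk (embeds_refl _)) (embeds_double nk kk).
  apply: embeds_trans (embeds_trans (embeds_prod lk sk) kk).
  by exists sval; apply: sval_inj.
- have unbounded j : exists a, cle j (h a).
    apply: contrapT => no; apply: (@initial_small lambda j).
    have H a : strict (@cle lambda) (h a) j.
      by apply: (wo_leNgt wol) => ja; apply: no; exists a.
    by exists (fun a => exist _ (h a) (H a)) => a a' [/hI].
  have /choice[r Hr] z : exists a, inW (h a) (inr z).
    have [j zj] := inWk z; have [a ja] := unbounded j.
    by exists a; apply: inW_mono ja _ zj.
  by exists (fun z => exist (fun q => inW (h q.1) q.2) (r z, inr z) (Hr z)) => z z' [].
- move=> t; apply: embeds_trans natl _.
  by exists (fun j => exist (fun s : Th => cls s = cls t)
    (exist (fun q => inW (h q.1) q.2) (cls t, inl j) (inWl _ j)) erefl) => j j' [].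
move=> k m t t' r tI t'I tt'.
have ty s : typical (p (key s)) (B `|` coords (x \o y) [set u | u <> s]) (x (y s)).
  apply: (typical_unordered cL st MT lt_wf lt_tr lt_to (p := fun s => p (key s))
    (c := fun s => c (key s))) s => //.
  - by move=> s; apply: up.
  - by move=> s z zc; right; exists (key s).
  - by move=> s; have [] := Hy s.
pose e (u : 'I_k -> Th) := sumf (iota \o r) (fun ij : 'I_k * 'I_n => c (key (u ij.1)) ij.2).
have Be u w : B (e u w).
  by case: w => [j|[i j]]; [left; exists (r j)|right; exists (key (u i)), j].
have E : equi (sumf (e t) (fun ij : 'I_k * 'I_d => (x \o y) (t ij.1) ij.2))
              (sumf (e t') (fun ij : 'I_k * 'I_d => (x \o y) (t' ij.1) ij.2)).
  apply: (@typical_family_equi L M Th d n (fun s => p (key s)) (fun s => c (key s))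
     (x \o y) B _ (e t) (e t') k t t' (fun i j => inr (i, j))) => //.
  - by move=> s s'; apply: up.
  - exact: embeds_countType.
  - by move=> i j; split=> [/tI->|/t'I->].
  - exact: (hE k m (cls \o t) (cls \o t')).
pose g (v : 'I_m + 'I_k * 'I_d) : ('I_m + 'I_k * 'I_n) + 'I_k * 'I_d :=
  match v with inl j => inl (inl j) | inr w => inr w end.
have F w u : sumf (iota \o r) u = sumf (e w) u \o g by apply/funext => -[].
by rewrite (F t) (F t'); apply: equi_comp.
Qed.

End Blocks.

(** * Large indiscernible sets *)

Theorem theorem2p5 (L : language) (T : set (sentence L))
    (kappa lambda : cardinal) (d : nat) :
  countable_language L -> complete_theory T -> omega_stable T ->
  singular kappa -> is_cof kappa lambda ->
  card_lt [set: nat] [set: lambda] ->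
  forall (M : fo_structure L) (A : set M) (X : set ('I_d -> M)),
    is_model T M ->
    card_lt A [set: lambda] ->
    [set: kappa] #<= X ->
  exists (Y : set ('I_d -> M)) (E : ('I_d -> M) -> ('I_d -> M) -> Prop),
    [/\ Y `<=` X, Y #= [set: kappa] & equivalence_on Y E] /\
    [/\ eq_classes Y E #<= [set: lambda],
        forall C, eq_classes Y E C -> infinite_set C &
        indiscernible A Y E].
Proof.
move=> cL _ st [_ [lambda' [[C' [C'cof C'E]] _] [_ nk]]] cof [_ nl].
move=> M A X MT /card_lt_embeds[_ nA] kX.
have lambda_unc : ~ embeds lambda nat by move=> /card_leT_embeds.
have lambda_lt : ~ embeds kappa lambda.
  move=> /card_leT_embeds kl; apply: nk; apply: card_le_trans kl _.
  have [_ /(_ C' C'cof) lC'] := cof; apply: card_le_trans lC' _.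
  by move: C'E; rewrite card_eq_le => /andP[].
have [U [UU Uoo]] := nonprincipal_ultrafilter.
pose N := ultrapower M U.
have NT : is_model T N := ultrapower_model UU MT.
have hN : homogeneous N := ultrapower_homogeneous UU cL Uoo.
pose j (m : M) : N := upi U (fun=> m).
have jI : injective j.
  by move=> m m' /upi_eq H; have [k] := filter_ex H.
pose x (a : set_type X) (i : 'I_d) : N := j (\val a i).
pose iota (a : set_type A) : N := j (\val a).
have kX' : embeds kappa (set_type X).
  by apply: embeds_trans (set_type_setT kappa) _; apply/card_le_embeds.
have [Th [cls [h [hI Tk kT clsoo hE]]]] :=
  generic_blocks cL st NT hN cof lambda_unc lambda_lt x iota nA kX'.
pose y t : 'I_d -> M := \val (h t).
have yI : injective y by move=> s t /val_inj/hI.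
pose E u v := exists s t, [/\ y s = u, y t = v & cls s = cls t].
exists (range y), E.
have yE s t : E (y s) (y t) <-> cls s = cls t.
  by split=> [[s' [t' [/yI-> /yI->]]]//|st']; exists s, t.
split; split.
- by move=> _ [t _ <-]; apply: set_valP.
- rewrite card_eq_le; apply/andP; split.
    apply: card_le_trans (card_image_le _ _) _.
    by apply/card_leT_embeds.
  apply: card_le_trans (_ : [set: Th] #<= _); first exact/card_leT_embeds.
  apply/card_le_embeds.
  have H (t : set_type [set: Th]) : range y (y (\val t)) by exists (\val t).
  by exists (fun t => SigSub (mem_set (H t))) => s t [/yI/val_inj].
- split.
  + by move=> _ [t _ <-]; apply/yE.
  + by move=> _ _ [s _ <-] [t _ <-] /yE st'; apply/yE.
  + by move=> _ _ _ [s _ <-] [t _ <-] [u _ <-] /yE st' /yE tu; apply/yE; rewrite st'.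
- have [l0] : inhabited lambda.
    by have [i0 _] := nat_embeds_lambda lambda_unc; constructor; exact: i0 0.
  apply/card_le_embeds; apply: embeds_trans (set_type_setT lambda).
  have /choice[r Hr] (C : set_type (eq_classes (range y) E)) :
      exists l, \val C = [set u | exists2 t, cls t = l & y t = u].
    have [_ [t _ <-] <-] := set_valP C; exists (cls t).
    apply/seteqP; split=> [_ [[s _ <-] /yE ts]|_ [s ts <-]].
      by exists s.
    by split; [exists s|apply/yE].
  by exists r => C D CD; apply: val_inj; rewrite !Hr CD.
- move=> _ [_ [t _ <-] <-] /finite_setPn; apply.
  have [g gI] := clsoo t.
  apply/card_le_embeds; apply: embeds_trans (embeds_val _) _.
  have H n : eq_class (range y) E (y t) (y (sval (g n))).
    by split; [exists (sval (g n))|apply/yE; rewrite (svalP (g n))].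
  by exists (fun n => SigSub (mem_set (H n))) => n n' [/yI/sval_inj/gI].
move=> n a b Ya Yb aI bI ab phi.
have /choice[t Ht] i : exists t, y t = a i by have [t _ <-] := Ya i; exists t.
have /choice[t' Ht'] i : exists t, y t = b i by have [t'' _ <-] := Yb i; exists t''.
have tI : injective t by move=> i i' ii'; apply: aI; rewrite -!Ht ii'.
have t'I : injective t' by move=> i i' ii'; apply: bI; rewrite -!Ht' ii'.
have tt' i i' : cls (t i) = cls (t i') <-> cls (t' i) = cls (t' i').
  have lt_case (k l : 'I_n) : k < l -> cls (t k) = cls (t l) <-> cls (t' k) = cls (t' l).
    by move=> kl; have := ab k l kl; rewrite -!Ht -!Ht' !yE.
  case: (ltngtP i i') => [/lt_case//|/lt_case[H1 H2]|/val_inj-> //].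
  by split=> eqc; apply/esym; [apply: H1|apply: H2].
have [m [r [psi psiE]]] := finite_params
  (unconst phi (inl : 'I_n * 'I_d -> _) (inr : set_type A -> 'I_n * 'I_d + set_type A)).
have key (c : 'I_n -> 'I_d -> M) (u : 'I_n -> Th) : (forall i, y (u i) = c i) ->
    @sat _ (expansion A) _ phi (fun ij => c ij.1 ij.2) <->
    sat (ren psi (fun v => match v with inl w => inr w | inr k => inl k end))
      (sumf (iota \o r) (fun ij : 'I_n * 'I_d => x (h (u ij.1)) ij.2)).
  move=> uc; rewrite sat_ren.
  have -> : sumf (iota \o r) (fun ij : 'I_n * 'I_d => x (h (u ij.1)) ij.2) \o
      (fun v => match v with inl w => inr w | inr k => inl k end) =
      (fun v => j (sumf (fun ij => c ij.1 ij.2) (fun k => \val (r k)) v)).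
    by apply/funext => -[w|k] //=; rewrite -uc.
  rewrite (ultrapower_diag UU).
  have -> : (sumf (fun ij : 'I_n * 'I_d => c ij.1 ij.2) (fun k => \val (r k)) : _ -> M) =
      sumf (fun ij => c ij.1 ij.2) (fun a : set_type A => \val a) \o sum_shift r.
    by apply/funext => -[].
  rewrite -sat_ren -psiE sat_unconst //.
by rewrite (key a t Ht) (key b t' Ht'); apply: hE.
Qed.
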